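(* Let $\mathcal M\in\mathbf{HC}$ be transitive, let $\pi=\langle\mathbb P_\xi:\xi\in|\pi|\rangle\in\mathcal M$ be a small multiforcing, and let $\rho$ be an $\mathcal M$-generic refinement of $\pi$. If $\Delta\in\mathcal M^+$, $\Delta\subseteq\mathrm{MT}(\pi)$, and $\Delta$ is open dense in $\mathrm{MT}(\pi)$, then $\pi\sqsubset_\Delta\rho$.
   Context: $\mathbf{HC}$: hereditarily countable sets. For $\mathcal M\in\mathbf{HC}$, $\mathcal M^+$ is the set of all $X\in\mathbf{HC}$ definable in $\langle\mathbf{HC},\in\rangle$ by formulas with parameters in $\mathcal M$. $\mathbf{PT}$: perfect trees $T\subseteq2^{<\omega}$, $[T]$ the branches, $T|s=\{t\in T:s\subseteq t\lor t\subseteq s\}$. An arboreal forcing is $\mathbb P\subseteq\mathbf{PT}$ with $T|u\in\mathbb P$ whenever $u\in T\in\mathbb P$; $\mathbb P^{\cup}$ is the set of finite unions of its trees. $\mathbb P\sqsubset\mathbb Q$ means: every $T\in\mathbb P$ contains some $Q\in\mathbb Q$; every $Q\in\mathbb Q$ is covered by finitely many trees of $\mathbb P$; for $Q\in\mathbb Q$, $T\in\mathbb P$, $[Q]\cap[T]$ is clopen in $[Q]$ and $T\not\subseteq Q$. A multiforcing is a function $\pi$ with domain $|\pi|\subseteq\omega_1$ whose values are arboreal forcings; small if $|\pi|$ and all $\pi(\xi)$ are countable; $\pi\sqsubset\rho$ means $|\pi|\subseteq|\rho|$ and $\pi(\xi)\sqsubset\rho(\xi)$ for $\xi\in|\pi|$.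 A multitree is a function $p$ with finite domain $|p|\subseteq\omega_1$ and values in $\mathbf{PT}$; $[p]=\{x\in(2^\omega)^{\omega_1}:\forall\xi\in|p|\,x(\xi)\in[p(\xi)]\}$. $\mathrm{MT}(\pi)$ is the set of multitrees $p$ with $|p|\subseteq|\pi|$ and $p(\xi)\in\pi(\xi)$, ordered by $q\le p$ iff $|p|\subseteq|q|$ and $q(\xi)\subseteq p(\xi)$ for $\xi\in|p|$; (open) density is w.r.t. $\le$. Sealing: $u\sqsubseteq^{\mathrm{fin}}\bigvee Z$ means there is finite $Z'\subseteq Z$ with $|v|=|u|$ for $v\in Z'$ and $[u]\subseteq\bigcup_{v\in Z'}[v]$. $\pi\sqsubset_\Delta\rho$ means $\pi\sqsubset\rho$ and: whenever $p\in\mathrm{MT}(\pi)$, $u\in\mathrm{MT}(\rho)$, $|u|\subseteq|\pi|$, $|u|\cap|p|=\emptyset$, there is $q\in\mathrm{MT}(\pi)$ with $q\le p$, $|q|\cap|u|=\emptyset$ and $u\sqsubseteq^{\mathrm{fin}}\bigvee\{u'\in\mathrm{MT}(\pi):|u'|=|u|,\ u'\cup q\in\Delta\}$. Generic refinement: on $\omega\times\mathbf{PT}$, $\langle n,T\rangle\preccurlyeq\langle m,S\rangle$ iff $m\le n$, $T\subseteq S$, $T\cap2^m=S\cap2^m$. A $\pi$-system is a function $\varphi$ with finite domain $|\varphi|\subseteq|\pi|\times\omega$ and $\varphi(\xi,k)\in\pi(\xi)^{\cup}$; $\langle n,\varphi\rangle\preccurlyeq\langle m,\psi\rangle$ iff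 $|\psi|\subseteq|\varphi|$ and $\langle n,\varphi(\xi,k)\rangle\preccurlyeq\langle m,\psi(\xi,k)\rangle$ for $\langle\xi,k\rangle\in|\psi|$. Take a $\preccurlyeq$-decreasing sequence $\langle\langle n_j,\varphi_j\rangle:j<\omega\rangle$, with $n_0<n_1<\cdots$, meeting every open dense set of such pairs that belongs to $\mathcal M^+$; for $\xi\in|\pi|,k<\omega$ let $Q_{\xi k}=\bigcap_{j\ge j(\xi,k)}\varphi_j(\xi,k)$ where $\langle\xi,k\rangle\in|\varphi_j|$ for all $j\ge j(\xi,k)$, and $\mathbb Q_\xi=\{Q_{\xi k}|s:k<\omega,s\in Q_{\xi k}\}$. Then $\rho=\langle\mathbb Q_\xi:\xi\in|\pi|\rangle$ is called an $\mathcal M$-generic refinement of $\pi$. *)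

(* Defs.v *)
From HB Require Import structures.
From mathcomp Require Import all_boot.
From mathcomp Require Import boolp classical_sets functions cardinality.
From mathcomp Require Import topology cantor.
From mathcomp Require Import generic_quotient.

Set Implicit Arguments.
Unset Strict Implicit.
Unset Printing Implicit Defensive.

Local Open Scope classical_set_scope.
Local Open Scope quotient_scope.

(** * The structure <HC, ∈>

  A hereditarily countable set is presented by a well-founded tree that is
  either empty or has its immediate subtrees enumerated (with repetitions
  allowed) by [nat]; [HC] is the quotient by extensional equality.  The lemmas
  [HC_ext], [HC_wf], [countable_ext] and [hcsetE] determine <HC, ∈> up to
  isomorphism.  *)
Inductive hctree : Type := HCnil | HCseq of (nat -> hctree).

HB.instance Definition _ := gen_eqMixin hctree.
HB.instance Definition _ := gen_choiceMixin hctree.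

Fixpoint hcteq (s t : hctree) : Prop :=
  match s, t with
  | HCnil, HCnil => True
  | HCseq f, HCseq g => (forall n, exists m, hcteq (f n) (g m)) /\
                        (forall m, exists n, hcteq (f n) (g m))
  | _, _ => False
  end.

Definition hcteqb (s t : hctree) : bool := `[< hcteq s t >].

Lemma hcteqb_refl : reflexive hcteqb.
Proof.
move=> t; apply/asboolP; elim: t => [|f IHf] //=.
by split=> n; exists n.
Qed.

Lemma hcteqb_sym : symmetric hcteqb.
Proof.
suff sym s t : hcteq s t -> hcteq t s.
  by move=> s t; apply/asboolP/asboolP; apply: sym.
elim: s t => [|f IHf] [|g] //= [fg gf].
split=> n.
  by have [m] := gf n; exists m; exact: IHf.
by have [m] := fg n; exists m; exact: IHf.
Qed.

Lemma hcteqb_trans : transitive hcteqb.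
Proof.
suff tr s t u : hcteq s t -> hcteq t u -> hcteq s u.
  by move=> t s u /asboolP st /asboolP tu; apply/asboolP; apply: tr st tu.
elim: s t u => [|f IHf] [|g] [|h] //= [fg gf] [gh hg].
split=> n.
  by have [m fgm] := fg n; have [k ghk] := gh m; exists k; apply: IHf fgm ghk.
by have [m ghm] := hg n; have [k fgk] := gf m; exists k; apply: IHf fgk ghm.
Qed.

Canonical hcteq_equiv := EquivRel hcteqb hcteqb_refl hcteqb_sym hcteqb_trans.

Definition HC : Type := {eq_quot hcteq_equiv}.

HB.instance Definition _ := EqQuotient.on HC.
HB.instance Definition _ := Choice.on HC.

Definition hmem (x y : HC) : Prop :=
  if repr y is HCseq f then exists n, x = \pi_HC (f n) else False.

Notation "x ∈ y" := (hmem x y) (at level 70, no associativity).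
Notation "x ∉ y" := (~ hmem x y) (at level 70, no associativity).

Definition ext (x : HC) : set HC := [set y | y ∈ x].

Definition hc0 : HC := \pi_HC HCnil.

(** The hereditarily countable set with extension [A]; junk value [hc0] when
    [A] is uncountable. *)
Definition hcset (A : set HC) : HC := xget hc0 [set x | ext x = A].

Lemma hcteq_pi (s t : hctree) : \pi_HC s = \pi_HC t <-> hcteq s t.
Proof.
split=> [/eqmodP /asboolP //|st].
by apply/eqmodP; apply/asboolP.
Qed.

Lemma ext_seq (f : nat -> hctree) :
  ext (\pi_HC (HCseq f)) = [set \pi_HC (f n) | n in [set: nat]].
Proof.
have := reprK (\pi_HC (HCseq f)); move/hcteq_pi.
rewrite /ext /hmem; case: (repr _) => [|g] //= [gf fg].
apply/seteqP; split=> x /=.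
  by move=> [n ->]; have [m /hcteq_pi gfm] := gf n; exists m.
by move=> [n _ <-]; have [m /hcteq_pi gfm] := fg n; exists m.
Qed.

Lemma ext0 : ext hc0 = set0.
Proof.
have := reprK hc0; move/hcteq_pi.
by rewrite /ext /hmem; case: (repr _) => [|g] //= _; apply/seteqP; split.
Qed.

Lemma HC_ext : injective ext.
Proof.
move=> x y; rewrite -[x]reprK -[y]reprK.
case: (repr x) => [|f]; case: (repr y) => [|g] //; rewrite -/hc0 ?ext0 ?ext_seq.
- by move=> /seteqP[_ /(_ (\pi_HC (g 0)))] [] //; exists 0.
- by move=> /seteqP[/(_ (\pi_HC (f 0))) + _] => -[] //; exists 0.
move=> /seteqP[fg gf]; apply/hcteq_pi; split=> n.
  by have [|m _ /esym/hcteq_pi] := fg (\pi_HC (f n)); [exists n|exists m].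
by have [|m _ /hcteq_pi] := gf (\pi_HC (g n)); [exists n|exists m].
Qed.

Lemma HC_wf : well_founded hmem.
Proof.
move=> x; rewrite -[x]reprK; elim: (repr x) => [|f IHf]; constructor=> y.
  by rewrite -[_ ∈ _]/(ext hc0 y) ext0.
by rewrite -[_ ∈ _]/(ext _ y) ext_seq => -[n _ <-].
Qed.

Lemma countable_ext (x : HC) : countable (ext x).
Proof.
rewrite -[x]reprK; case: (repr x) => [|f]; first by rewrite -/hc0 ext0.
by rewrite ext_seq; apply: card_le_trans (card_image_le _ _) _.
Qed.

Lemma hcsetE (A : set HC) : countable A -> ext (hcset A) = A.
Proof.
move=> cA; rewrite /hcset; case: xgetP => [x _ //|/(_ _) noA].
have [A0|/set0P[a Aa]] := eqVneq A set0; first by rewrite ext0 A0.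
have [f fA] : exists f : nat -> HC, A = [set f n | n in [set: nat]].
  move/countable_injP: cA => [g ginj].
  exists (fun n => xget a [set x | A x /\ g x = n]).
  apply/seteqP; split=> [x Ax|_ [n _ <-]].
    exists (g x) => //; case: xgetP => [y _ [Ay gy]|/(_ x)]; last by case.
    by apply: ginj; rewrite ?inE.
  by case: xgetP => // y _ [].
exfalso; apply: (noA (\pi_HC (HCseq (fun n => repr (f n))))) => /=.
rewrite ext_seq fA; apply/seteqP; split=> _ [n _ <-]; exists n => //.
  by rewrite reprK.
by rewrite reprK.
Qed.

(** * Definability over <HC, ∈> *)
Inductive formula : Type :=
| FMem of nat & nat
| FEq of nat & nat
| FNot of formula
| FAnd of formula & formula
| FAll of formula.

(** De Bruijn variables: [FAll] binds variable 0. *)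
Definition scons (a : HC) (e : nat -> HC) (n : nat) : HC :=
  if n is n'.+1 then e n' else a.

Fixpoint sat (e : nat -> HC) (f : formula) : Prop :=
  match f with
  | FMem i j => e i ∈ e j
  | FEq i j => e i = e j
  | FNot g => ~ sat e g
  | FAnd g h => sat e g /\ sat e h
  | FAll g => forall a, sat (scons a e) g
  end.

(** Variables beyond the parameter list denote the empty set, which is
    definable without parameters. *)
Definition Mplus (M : HC) : set HC :=
  [set X | exists (f : formula) (ps : seq HC),
     (forall a, a \in ps -> a ∈ M) /\
     ext X = [set y | sat (scons y (nth hc0 ps)) f]].

Definition htransitive (x : HC) : Prop := forall y, y ∈ x -> ext y `<=` ext x.

(** * Set-theoretic coding inside HC *)
Definition hsub (x y : HC) : Prop := ext x `<=` ext y.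

Definition hunion (x y : HC) : HC := hcset (ext x `|` ext y).

Definition opair (a b : HC) : HC :=
  hcset [set hcset [set a]; hcset [set a; b]].

Fixpoint num (n : nat) : HC :=
  if n is m.+1 then hcset (ext (num m) `|` [set num m]) else hc0.

Definition dom (f : HC) : set HC := [set x | exists y, opair x y ∈ f].

Definition functional (f : HC) : Prop :=
  (forall z, z ∈ f -> exists x y, z = opair x y) /\
  (forall x y y', opair x y ∈ f -> opair x y' ∈ f -> y = y').

(** Value of [f] at [x]; meaningful when [functional f] and [dom f x]. *)
Definition app (f x : HC) : HC := xget hc0 [set y | opair x y ∈ f].

(** The ordinals belonging to HC are exactly the countable ordinals. *)
Definition omega1 : set HC :=
  [set x | htransitive x /\ forall y, y ∈ x -> htransitive y].

(** * Perfect trees *)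

(** The restriction of [x] to [n], as a set-theoretic function from [n]
    to [2 = {0, 1}]. *)
Definition restr (x : cantor_space) (n : nat) : HC :=
  hcset [set opair (num i) (num (x i : bool)) | i in [set i | i < n]%N].

Definition strings_of_length (n : nat) : set HC :=
  [set restr x n | x in [set: cantor_space]].

Definition strings : set HC := \bigcup_n strings_of_length n.

Definition perfect_tree (T : HC) : Prop :=
  [/\ ext T `<=` strings, ext T !=set0,
      (forall s t, t ∈ T -> strings s -> hsub s t -> s ∈ T) &
      (forall s, s ∈ T -> exists t t', [/\ t ∈ T, t' ∈ T, hsub s t & hsub s t']
                                       /\ ~ hsub t t' /\ ~ hsub t' t)].

Definition branches (T : HC) : set cantor_space :=
  [set x | forall n, restr x n ∈ T].

Definition cone (T s : HC) : HC :=
  hcset [set t | t ∈ T /\ (hsub s t \/ hsub t s)].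

Definition arboreal (P : set HC) : Prop :=
  P `<=` perfect_tree /\ forall T u, P T -> u ∈ T -> P (cone T u).

(** Unions are over nonempty finite subfamilies, so that members of [fin_unions P]
    are again perfect trees. *)
Definition fin_unions (P : set HC) : set HC :=
  [set T | exists Z : set HC, [/\ finite_set Z, Z !=set0, Z `<=` P &
                                  ext T = \bigcup_(S in Z) ext S]].

Definition arb_refines (P Q : set HC) : Prop :=
  [/\ arboreal P, arboreal Q,
      (forall T, P T -> exists2 S, Q S & hsub S T),
      (forall S, Q S -> exists Z : set HC,
          [/\ finite_set Z, Z `<=` P & ext S `<=` \bigcup_(T in Z) ext T]) &
      (forall S T, Q S -> P T ->
          clopen (branches S `&` branches T : set (subspace (branches S)))
          /\ ~ hsub T S)].

(** * Multiforcings and multitrees *)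
Definition multiforcing (pi : HC) : Prop :=
  [/\ functional pi, dom pi `<=` omega1 &
      forall xi, dom pi xi -> arboreal (ext (app pi xi))].

(** A multiforcing that is an element of HC is automatically small. *)
Definition small_multiforcing (pi : HC) : Prop :=
  [/\ multiforcing pi, countable (dom pi) &
      forall xi, dom pi xi -> countable (ext (app pi xi))].

Definition mf_refines (pi rho : HC) : Prop :=
  [/\ multiforcing pi, multiforcing rho, dom pi `<=` dom rho &
      forall xi, dom pi xi -> arb_refines (ext (app pi xi)) (ext (app rho xi))].

Definition multitree (p : HC) : Prop :=
  [/\ functional p, finite_set (dom p), dom p `<=` omega1 &
      forall xi, dom p xi -> perfect_tree (app p xi)].

Definition box (p : HC) : set (omega1 -> cantor_space) :=
  [set x | forall xi : omega1, dom p (val xi) -> branches (app p (val xi)) (x xi)].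

Definition MT (pi : HC) : set HC :=
  [set p | [/\ multitree p, dom p `<=` dom pi &
               forall xi, dom p xi -> app p xi ∈ app pi xi]].

Definition mt_le (q p : HC) : Prop :=
  dom p `<=` dom q /\ forall xi, dom p xi -> hsub (app q xi) (app p xi).

Definition open_dense {T : Type} (le : T -> T -> Prop) (X D : set T) : Prop :=
  [/\ D `<=` X,
      (forall p, X p -> exists2 q, D q & le q p) &
      (forall p q, D p -> X q -> le q p -> D q)].

(** * Sealing *)
Definition fin_covered (u : HC) (Z : set HC) : Prop :=
  exists Z' : set HC, [/\ finite_set Z', Z' `<=` Z,
    (forall v, Z' v -> dom v = dom u) &
    box u `<=` \bigcup_(v in Z') box v].

Definition seals (Delta : set HC) (pi rho : HC) : Prop :=
  mf_refines pi rho /\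
  forall p u, MT pi p -> MT rho u -> dom u `<=` dom pi ->
    dom u `&` dom p = set0 ->
    exists q, [/\ MT pi q, mt_le q p, dom q `&` dom u = set0 &
      fin_covered u
        [set u' | [/\ MT pi u', dom u' = dom u & Delta (hunion u' q)]]].

(** * Generic refinements *)
Definition tree_le (n : nat) (T : HC) (m : nat) (S : HC) : Prop :=
  [/\ (m <= n)%N, hsub T S &
      ext T `&` strings_of_length m = ext S `&` strings_of_length m].

Definition system (pi phi : HC) : Prop :=
  [/\ functional phi, finite_set (dom phi),
      dom phi `<=` [set z | exists xi k, dom pi xi /\ z = opair xi (num k)] &
      forall xi k, dom phi (opair xi (num k)) ->
        fin_unions (ext (app pi xi)) (app phi (opair xi (num k)))].

Definition systems (pi : HC) : set (nat * HC) := [set z | system pi z.2].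

Definition system_le (z w : nat * HC) : Prop :=
  [/\ (w.1 <= z.1)%N, dom w.2 `<=` dom z.2 &
      forall i, dom w.2 i -> tree_le z.1 (app z.2 i) w.1 (app w.2 i)].

Definition code (z : nat * HC) : HC := opair (num z.1) z.2.

(** [D], a set of pairs <n, phi>, belongs to the class [C] of elements of HC. *)
Definition coded_in (C : set HC) (D : set (nat * HC)) : Prop :=
  exists2 X, C X & ext X = code @` D.

Definition generic_sequence (M pi : HC) (z : nat -> nat * HC) : Prop :=
  [/\ (forall j, systems pi (z j)),
      (forall j, system_le (z j.+1) (z j)),
      (forall j, (z j).1 < (z j.+1).1)%N &
      forall D, open_dense system_le (systems pi) D -> coded_in (Mplus M) D ->
        exists j, D (z j)].

Definition limit_tree (z : nat -> nat * HC) (xi : HC) (k : nat) : HC :=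
  hcset [set s | exists j0,
    (forall j, (j0 <= j)%N -> dom (z j).2 (opair xi (num k))) /\
    (forall j, (j0 <= j)%N -> s ∈ app (z j).2 (opair xi (num k)))].

Definition generic_refinement (M pi rho : HC) : Prop :=
  exists z, [/\ generic_sequence M pi z, functional rho, dom rho = dom pi &
    forall xi, dom pi xi ->
      ext (app rho xi) =
        [set T | exists k s, s ∈ limit_tree z xi k /\
                             T = cone (limit_tree z xi k) s]].

(* Main.v *)
Require Import Defs.
From mathcomp Require Import all_boot.
From mathcomp Require Import mathcomp_extra boolp classical_sets functions cardinality.
From mathcomp Require Import topology cantor.
Set Implicit Arguments.
Unset Strict Implicit.
Unset Printing Implicit Defensive.
Local Open Scope classical_set_scope.

(** Everything is read off dense sets of conditions definable over HC from
    parameters in [M].  Definability is handled semantically: relations on HC given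
    by formulas are closed under connectives, quantifiers and substitution of
    definable terms, and a set of conditions is countable, hence coded by an element of HC.

    Density always comes from one operation: given a finite union [S] of trees of
    [P] and a height [n], replace the part of [S] above each node of height [n] by a
    tree of [P] through that node.  For sealing, consider all choices of one node of
    height [n] in each of the finitely many trees concerned; each choice selects a
    multitree [w].  Treat the choices one after the other, refining [w] together with
    the side multitree [q] into Delta; since Delta is open, earlier choices are
    preserved.  A branch of the generic multitree passes, at every length,
    through one of the finitely many selected multitrees, hence lies entirely in one of
    them. *)

(** * Sets in HC *)

(** A condition sees only the domain of [u] and, for each [xi] in it, the number of the limit tree
    from which the value of [u] is cut. Both are finite data definable from elements of [M]. So the
    whole limit trees are sealed, and their cones are covered a fortiori. Transitivity is the only
    closure assumed of [M]: the trees of [pi] and the elements of its domain are members of [M] and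
    serve as parameters, whereas an index, a finite set of indices or a multitree need not be a
    member and enters through a definition from members. Branches are not objects of HC conditions
    either, so the cover is first stated for choices of nodes in the finitely many trees that a
    condition provides, and only at the end for branches. *)

Lemma HC_eqP (x y : HC) : x = y <-> forall z, z ∈ x <-> z ∈ y.
Proof. by split=> [->//|xy]; apply: HC_ext; apply/seteqP; split=> z /xy. Qed.

Lemma in_hcset (A : set HC) x : countable A -> x ∈ hcset A <-> A x.
Proof. by move=> /hcsetE E; rewrite -[_ ∈ _]/(ext (hcset A) x) E. Qed.

Lemma in_hc0 x : ~ x ∈ hc0.
Proof. by rewrite -[_ ∈ _]/(ext hc0 x) ext0. Qed.

Lemma hcset_ext x : hcset (ext x) = x.
Proof. by apply: HC_ext; rewrite hcsetE//; exact: countable_ext. Qed.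

Lemma in_irrefl x : ~ x ∈ x.
Proof. by elim/(well_founded_ind HC_wf): x => x IH xx; exact: (IH x). Qed.

Lemma in_hunion x y z : z ∈ hunion x y <-> z ∈ x \/ z ∈ y.
Proof.
apply: in_hcset; rewrite -bigcup2E; apply: bigcup_countable => //.
by move=> [|[|i]] _ //=; exact: countable_ext.
Qed.

Definition upair (a b : HC) : HC := hcset [set a; b].

Lemma in_upair a b z : z ∈ upair a b <-> z = a \/ z = b.
Proof. by apply: in_hcset; apply: finite_set_countable; exact: finite_set2. Qed.

Lemma opairE a b : opair a b = upair (upair a a) (upair a b).
Proof. by rewrite /opair /upair setUid. Qed.

Lemma upair_inj a b c d : upair a b = upair c d -> a = c /\ b = d \/ a = d /\ b = c.
Proof.
move=> /HC_eqP E.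
have [Ea Eb] := ((E a).1, (E b).1); have [Ec Ed] := ((E c).2, (E d).2).
move: Ea Eb Ec Ed; rewrite !in_upair.
move=> /(_ (or_introl erefl)) Ea /(_ (or_intror erefl)) Eb.
move=> /(_ (or_introl erefl)) Ec /(_ (or_intror erefl)) Ed.
by case: Ea Eb Ec Ed => [?|?] [?|?] [?|?] [?|?]; subst; auto.
Qed.

Lemma opair_inj a b c d : opair a b = opair c d -> a = c /\ b = d.
Proof.
rewrite !opairE => /upair_inj[[/upair_inj E /upair_inj F]|[/upair_inj E /upair_inj F]];
  by case: E F => -[? ?] [] [? ?]; subst; auto.
Qed.

Definition hsucc (x : HC) : HC := hunion x (upair x x).

Lemma in_hsucc x z : z ∈ hsucc x <-> z ∈ x \/ z = x.
Proof. by rewrite in_hunion in_upair; tauto. Qed.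

Lemma numS n : num n.+1 = hsucc (num n).
Proof.
rewrite /hsucc /hunion /=; congr (hcset (_ `|` _)).
by apply/seteqP; split=> z; rewrite /ext /= in_upair; tauto.
Qed.

Lemma in_num n z : z ∈ num n <-> exists2 i, i < n & z = num i.
Proof.
elim: n => [|n IH]; first by split=> [/in_hc0//|[]].
rewrite numS in_hsucc IH; split=> [[[i lin ->]|->]|[i]].
- by exists i; rewrite // ltnS ltnW.
- by exists n.
- by rewrite ltnS leq_eqVlt => /orP[/eqP->|lin] ->; [right|left; exists i].
Qed.

Lemma num_inj : injective num.
Proof.
move=> m n; wlog mn : m n / m < n => [H E|].
  by have [/H/(_ E)|/H/(_ (esym E))->|] := ltngtP m n.
by move=> E; exfalso; apply: (@in_irrefl (num m)); rewrite {2}E in_num; exists m.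
Qed.

(** Systems and multitrees have finite domains, while formulas speak of the finiteness of an element
    of HC; this equivalence mediates. *)
Lemma functional_finite f : functional f -> finite_set (ext f) <-> finite_set (dom f).
Proof.
move=> [f1 f2]; split=> fin.
  apply: (@sub_finite_set _ _ ((fun z => xget hc0 [set x | exists y, z = opair x y]) @` ext f)).
    move=> x [y xy]; exists (opair x y) => //.
    by case: xgetP => [x' _ [y' /opair_inj[]]//|/(_ x)]; case; exists y.
  exact: finite_image.
apply: (@sub_finite_set _ _ ((fun x => opair x (app f x)) @` dom f)).
  move=> z zf; have [x [y E]] := f1 z zf; subst z.
  exists x; first by exists y.
  rewrite /app; case: xgetP => [y' _ /= xy'|/(_ y)//].
  by congr opair; apply: (f2 x).
exact: finite_image.
Qed.

Lemma app_in f x : dom f x -> opair x (app f x) ∈ f.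
Proof. by case=> y xy; rewrite /app; case: xgetP => // /(_ y). Qed.

Lemma app_eq f x y : functional f -> opair x y ∈ f -> app f x = y.
Proof. by move=> [_ ff] xy; apply: (ff x) => //; apply: app_in; exists y. Qed.

Lemma in_functional f z :
  functional f -> z ∈ f <-> exists2 x, dom f x & z = opair x (app f x).
Proof.
move=> ff; split=> [zf|[x xf ->]]; last exact: app_in.
have [x [y E]] := ff.1 z zf; subst z.
by exists x; [exists y|rewrite (app_eq ff zf)].
Qed.

(** * Functions in HC given by their domain and values *)

Definition mkfun (A : set HC) (G : HC -> HC) : HC :=
  hcset [set opair x (G x) | x in A].

Section MkFun.
Variables (A : set HC) (G : HC -> HC).
Hypothesis cA : countable A.

Lemma in_mkfun z : z ∈ mkfun A G <-> exists2 x, A x & opair x (G x) = z.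
Proof. by apply: in_hcset; apply: sub_countable (card_image_le _ _) _. Qed.

Lemma pair_in_mkfun x y : opair x y ∈ mkfun A G <-> A x /\ y = G x.
Proof.
rewrite in_mkfun; split=> [[x' Ax' /opair_inj[<- <-]]//|[Ax ->]].
by exists x.
Qed.

Lemma mkfun_functional : functional (mkfun A G).
Proof.
split=> [z /in_mkfun[x _ <-]|x y y']; first by exists x, (G x).
by rewrite !pair_in_mkfun => -[_ ->] [_ ->].
Qed.

Lemma dom_mkfun : dom (mkfun A G) = A.
Proof.
apply/seteqP; split=> [x [y]|x Ax]; first by rewrite pair_in_mkfun => -[].
by exists (G x); rewrite pair_in_mkfun.
Qed.

Lemma app_mkfun x : A x -> app (mkfun A G) x = G x.
Proof. by move=> Ax; apply: app_eq mkfun_functional _; rewrite pair_in_mkfun. Qed.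

End MkFun.

Section UnionFun.
Variables f g : HC.
Hypotheses (ff : functional f) (gf : functional g) (fg0 : dom f `&` dom g = set0).

Lemma dom_hunion : dom (hunion f g) = dom f `|` dom g.
Proof.
apply/seteqP; split=> x.
  by case=> y; rewrite in_hunion => -[xy|xy]; [left|right]; exists y.
by case=> -[y xy]; exists y; rewrite in_hunion; [left|right].
Qed.

Lemma hunion_functional : functional (hunion f g).
Proof.
split=> [z|x y y']; first by rewrite in_hunion => -[/ff.1|/gf.1].
have no z : dom f z -> dom g z -> False.
  by move=> fz gz; rewrite -[False]/(set0 z) -fg0.
rewrite !in_hunion => -[xy|xy] [xy'|xy']; [exact: ff.2 xy xy'| | |exact: gf.2 xy xy'].
  by exfalso; apply: (no x); [exists y|exists y'].
by exfalso; apply: (no x); [exists y'|exists y].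
Qed.

Lemma app_hunionl x : dom f x -> app (hunion f g) x = app f x.
Proof.
move=> fx; apply: app_eq hunion_functional _.
by rewrite in_hunion; left; exact: app_in.
Qed.

Lemma app_hunionr x : dom g x -> app (hunion f g) x = app g x.
Proof.
move=> gx; apply: app_eq hunion_functional _.
by rewrite in_hunion; right; exact: app_in.
Qed.

End UnionFun.

(** * Definability with parameters *)

Fixpoint rename (r : nat -> nat) (f : formula) : formula :=
  match f with
  | FMem i j => FMem (r i) (r j)
  | FEq i j => FEq (r i) (r j)
  | FNot g => FNot (rename r g)
  | FAnd g h => FAnd (rename r g) (rename r h)
  | FAll g => FAll (rename (fun n => if n is m.+1 then (r m).+1 else 0) g)
  end.

Lemma sat_rename e r f : sat e (rename r f) <-> sat (e \o r) f.
Proof.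
elim: f e r => //= [g IH|g IHg h IHh|g IH] e r.
- by rewrite IH.
- by rewrite IHg IHh.
suff E a : scons a e \o (fun n => if n is m.+1 then (r m).+1 else 0) =
           scons a (e \o r).
  by split=> H a; have := H a; rewrite IH E.
by apply: funext => -[].
Qed.

(** Only finitely many variables occur in a formula; this lets an infinite parameter assignment be
    cut down to the finite list demanded by [Mplus]. *)
Lemma sat_local f :
  exists N, forall e e', (forall n, n < N -> e n = e' n) -> sat e f <-> sat e' f.
Proof.
elim: f => /= [i j|i j|g [N IH]|g [N IHg] h [N' IHh]|g [N IH]].
- exists (i + j).+1 => e e' E; rewrite !E// ltnS ?leq_addr ?leq_addl//.
- exists (i + j).+1 => e e' E; rewrite !E// ltnS ?leq_addr ?leq_addl//.
- by exists N => e e' E; rewrite (IH e e').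
- exists (N + N') => e e' E; rewrite (IHg e e') 1?(IHh e e')// => n nN; apply: E.
    by rewrite ltn_addl.
  by rewrite ltn_addr.
- exists N => e e' E.
  have H a : sat (scons a e) g <-> sat (scons a e') g.
    by apply: IH => -[|n] //= nN; apply: E; exact: ltnW.
  by split=> H' a; apply/H.
Qed.

(** Even positions hold the arguments and odd positions the parameters. *)
Definition interleave (e p : nat -> HC) (n : nat) : HC :=
  if odd n then p n./2 else e n./2.

(** A parameter [hc0] is allowed because it is the default value of [nth] in
    [Mplus]. *)
Definition definable (M : HC) (P : (nat -> HC) -> Prop) : Prop :=
  exists f p, (forall n, p n ∈ M \/ p n = hc0) /\
              forall e, sat (interleave e p) f <-> P e.

(** The language has no function symbols, so a term is given by its graph, with the value in
    variable 0. *)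
Definition definable_term (M : HC) (t : (nat -> HC) -> HC) : Prop :=
  definable M (fun e => e 0 = t (fun n => e n.+1)).

Section Definable.
Variable M : HC.
Implicit Types (P Q : (nat -> HC) -> Prop) (s t : (nat -> HC) -> HC).
Local Notation def := (definable M).
Local Notation term := (definable_term M).

Lemma def_ext P Q : (forall e, P e <-> Q e) -> def P -> def Q.
Proof. by move=> PQ [f [p [pM fP]]]; exists f, p; split=> // e; rewrite fP. Qed.

Lemma def_var_mem i j : def (fun e => e i ∈ e j).
Proof.
exists (FMem i.*2 j.*2), (fun=> hc0); split=> [|e] /=; first by right.
by rewrite /interleave !odd_double !doubleK.
Qed.

Lemma def_var_eq i j : def (fun e => e i = e j).
Proof.
exists (FEq i.*2 j.*2), (fun=> hc0); split=> [|e] /=; first by right.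
by rewrite /interleave !odd_double !doubleK.
Qed.

Lemma def_not P : def P -> def (fun e => ~ P e).
Proof. by move=> [f [p [pM fP]]]; exists (FNot f), p; split=> //= e; rewrite fP. Qed.

Lemma def_and P Q : def P -> def Q -> def (fun e => P e /\ Q e).
Proof.
move=> [f [p [pM fP]]] [g [q [qM gQ]]].
(* The two parameter sequences are interleaved in turn: parameter [m] of [p] sits at variable
   [4m+1], that of [q] at [4m+3]. *)
pose r1 n := if odd n then n./2.*2.*2.+1 else n.
pose r2 n := if odd n then n./2.*2.+1.*2.+1 else n.
exists (FAnd (rename r1 f) (rename r2 g)), (interleave p q); split=> [n|e] /=.
  by rewrite /interleave; case: ifP.
rewrite !sat_rename -fP -gQ.
have -> : interleave e (interleave p q) \o r1 = interleave e p.
  apply: funext => n; rewrite /comp /r1.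
  case: ifP => on; rewrite /interleave on //.
  by rewrite /= !odd_double /= uphalf_double odd_double doubleK.
have -> // : interleave e (interleave p q) \o r2 = interleave e q.
apply: funext => n; rewrite /comp /r2.
case: ifP => on; rewrite /interleave on //.
by rewrite /= !odd_double /= uphalf_double /= odd_double /= uphalf_double.
Qed.

Lemma def_all (Q : HC -> (nat -> HC) -> Prop) :
  def (fun e => Q (e 0) (fun n => e n.+1)) -> def (fun e => forall a, Q a e).
Proof.
move=> [f [p [pM fP]]].
(* [FAll] shifts every variable by one and would exchange the parities, so odd positions move up and
   even ones down; position 0 stays and becomes the bound variable. *)
pose r n := if odd n then n.+1 else n.-1.
exists (FAll (rename r f)), p; split=> //= e.
suff H a : sat (scons a (interleave e p)) (rename r f) <-> Q a e.
  by split=> H' a; apply/H.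
rewrite sat_rename.
have -> : scons a (interleave e p) \o r = interleave (scons a e) p.
  apply: funext => -[|[|n]] //=; rewrite /r /= negbK.
  by rewrite /interleave /=; case: (boolP (odd n)) => [|/negbTE] /= ->.
by rewrite fP.
Qed.

Lemma def_rename r P : def P -> def (fun e => P (e \o r)).
Proof.
move=> [f [p [pM fP]]].
exists (rename (fun n => if odd n then n else (r n./2).*2) f), p; split=> // e.
rewrite sat_rename -fP.
set e1 := (X in sat X f); suff -> : e1 = interleave (e \o r) p by [].
apply: funext => n; rewrite /e1 /interleave /=.
by case: (boolP (odd n)) => [->//|_]; rewrite odd_double doubleK.
Qed.

Lemma def_or P Q : def P -> def Q -> def (fun e => P e \/ Q e).
Proof.
move=> dP dQ; apply: def_ext (def_not (def_and (def_not dP) (def_not dQ))) => e.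
by rewrite -not_orP notK.
Qed.

Lemma def_imp P Q : def P -> def Q -> def (fun e => P e -> Q e).
Proof.
move=> dP dQ; apply: def_ext (def_or (def_not dP) dQ) => e.
by rewrite implyE.
Qed.

Lemma def_iff P Q : def P -> def Q -> def (fun e => P e <-> Q e).
Proof. by move=> dP dQ; apply: def_and; apply: def_imp. Qed.

Lemma def_ex (Q : HC -> (nat -> HC) -> Prop) :
  def (fun e => Q (e 0) (fun n => e n.+1)) -> def (fun e => exists a, Q a e).
Proof.
move=> dQ; apply: def_ext (def_not (@def_all (fun a e => ~ Q a e) (def_not dQ))) => e.
by rewrite -existsNP; split=> -[a]; rewrite ?notK => H; exists a; rewrite ?notK.
Qed.

Lemma term_var i : term (fun e => e i).
Proof. exact: (def_var_eq 0 i.+1). Qed.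

(** Substituting a term costs a quantifier: its value is named, and [R] is asserted of the name. *)
Lemma def_app1 (R : HC -> Prop) t :
  def (fun e => R (e 0)) -> term t -> def (fun e => R (t e)).
Proof.
move=> dR dt; apply: (@def_ext (fun e => exists a, a = t e /\ R a)) => [e|].
  by split=> [[_ [-> //]]|]; exists (t e).
by apply: def_ex; apply: def_and.
Qed.

Lemma def_app2 (R : HC -> HC -> Prop) t s :
  def (fun e => R (e 0) (e 1)) -> term t -> term s -> def (fun e => R (t e) (s e)).
Proof.
move=> dR dt ds.
apply: (@def_ext (fun e => exists a, a = t e /\ exists b, b = s e /\ R a b)) => [e|].
  by split=> [[_ [-> [_ [-> //]]]]|]; exists (t e); split=> //; exists (s e).
apply: def_ex; apply: def_and => //; apply: def_ex; apply: def_and.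
  exact: (def_rename (fun n => if n is m.+1 then m.+2 else 0) ds).
exact: (def_rename (fun n => if n is 0 then 1 else 0) dR).
Qed.

Lemma def_app3 (R : HC -> HC -> HC -> Prop) t s u :
  def (fun e => R (e 0) (e 1) (e 2)) -> term t -> term s -> term u ->
  def (fun e => R (t e) (s e) (u e)).
Proof.
move=> dR dt ds du.
apply: (@def_ext (fun e => exists a, a = t e /\ exists b, b = s e /\
                           exists c, c = u e /\ R a b c)) => [e|].
  split=> [[_ [-> [_ [-> [_ [-> //]]]]]]|].
  by exists (t e); split=> //; exists (s e); split=> //; exists (u e).
apply: def_ex; apply: def_and => //; apply: def_ex; apply: def_and.
  exact: (def_rename (fun n => if n is m.+1 then m.+2 else 0) ds).
apply: def_ex; apply: def_and.
  exact: (def_rename (fun n => if n is m.+1 then m.+3 else 0) du).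
(* The innermost quantifier binds variable 0, so the three arguments appear in reverse order. *)
exact: (def_rename (fun n => 2 - n) dR).
Qed.

Lemma def_mem t s : term t -> term s -> def (fun e => t e ∈ s e).
Proof. exact: (def_app2 (def_var_mem 0 1)). Qed.

Lemma def_eq t s : term t -> term s -> def (fun e => t e = s e).
Proof. exact: (def_app2 (def_var_eq 0 1)). Qed.

Lemma term_app2 (F : HC -> HC -> HC) t s :
  def (fun e => e 0 = F (e 1) (e 2)) -> term t -> term s ->
  term (fun e => F (t e) (s e)).
Proof.
move=> dF dt ds; apply: (@def_app3 (fun x y z => x = F y z) (fun e => e 0)
  (fun e => t (fun n => e n.+1)) (fun e => s (fun n => e n.+1))) => //.
- exact: term_var.
- exact: (def_rename (fun n => if n is m.+1 then m.+2 else 0) dt).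
- exact: (def_rename (fun n => if n is m.+1 then m.+2 else 0) ds).
Qed.

Lemma term_param c : c ∈ M -> term (fun=> c).
Proof.
move=> cM; exists (FEq 0 1), (fun=> c); split=> [|e]; first by left.
by rewrite /interleave.
Qed.

End Definable.

(** Hooks called by [def_step]; they are redefined as further notions are shown definable, which
    extends [definability] to them. *)
Ltac set_notion := fail.
Ltac function_notion := fail.
Ltac def_step :=
  match goal with
  | H : definable_term ?M ?t |- definable_term ?M ?t => exact: H
  | |- definable_term _ (fun e => e _) => exact: term_var
  | |- definable _ (fun e => @?P e <-> @?Q e) => apply: def_iff
  | |- definable _ (fun e => @?P e /\ @?Q e) => apply: def_and
  | |- definable _ (fun e => @?P e \/ @?Q e) => apply: def_or
  | |- definable _ (fun e => ~ @?P e) => apply: def_not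
  | |- definable _ (fun e => exists x : HC, @?P e x) => apply: def_ex
  | |- definable _ (fun e => forall x : HC, @?P e x) => apply: def_all
  | |- definable _ (fun e => @?P e -> @?Q e) => apply: def_imp
  | |- definable _ (fun e => @?P e = @?Q e) => apply: def_eq
  | |- definable _ (fun e => @?P e ∈ @?Q e) => apply: def_mem
  | |- _ => first [set_notion | function_notion]
  end.
Ltac definability := repeat (cbv beta; def_step).

(** * Finite and countable sets in HC *)

Lemma finite_set_rect (P : set HC -> Prop) : P set0 ->
  (forall x A, finite_set A -> P A -> P (x |` A)) -> forall A, finite_set A -> P A.
Proof.
move=> P0 PS A /finite_seqP[s ->]; elim: s => [|x s IH].
  by rewrite (_ : [set` [::]] = set0) //; apply/seteqP; split.
rewrite (_ : [set` _] = x |` [set` s]); first by apply: PS => //; exact: finite_seq.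
apply/seteqP; split=> y /=; rewrite inE; first by case/predU1P; [left|right].
by case=> [->|ys]; apply/orP; [left|right].
Qed.

Lemma sub_image_countable T U (A : set T) (B : set U) (f : U -> T) :
  A `<=` f @` B -> countable B -> countable A.
Proof.
move=> AB; apply: sub_countable; apply: card_le_trans (card_image_le f B).
exact: subset_card_le.
Qed.

(** Makes the family of finite subsets of a countable set an element of HC: a witness in [finiteP],
    a bound in [countable_systems]. *)
Lemma countable_finite_subsets (A : set HC) : countable A ->
  countable [set x | ext x `<=` A /\ finite_set (ext x)].
Proof.
move=> /countable_finite_subset; apply: (@sub_image_countable _ _ _ _ hcset) => x xA.
by exists (ext x); rewrite ?hcset_ext.
Qed.

Lemma ext_hunion x y : ext (hunion x y) = ext x `|` ext y.
Proof. by apply/seteqP; split=> z; rewrite /ext /setU /= in_hunion. Qed.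

Lemma ext_upair x y : ext (upair x y) = [set x; y].
Proof. by apply/seteqP; split=> z; rewrite /ext /= in_upair. Qed.

Lemma hcset_setU1 x (A : set HC) :
  finite_set A -> hcset (x |` A) = hunion (hcset A) (upair x x).
Proof.
move=> fA; apply: HC_ext.
rewrite ext_hunion ext_upair !hcsetE ?setUid 1?setUC //; apply: finite_set_countable => //.
by rewrite finite_setU.
Qed.

Lemma finite_hcpowerset (A : set HC) :
  finite_set A -> finite_set [set x | ext x `<=` A].
Proof.
elim/finite_set_rect: A / => [|x A fA IH].
  apply: sub_finite_set (finite_set1 hc0) => x /= x0.
  by apply: HC_ext; rewrite ext0; apply/seteqP; split=> z // /x0.
apply: (@sub_finite_set _ _ ([set y | ext y `<=` A] `|`
    (fun y => hunion y (upair x x)) @` [set y | ext y `<=` A])).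
  move=> y /= yA; have [xy|xy] := pselect (x ∈ y).
    right; exists (hcset (ext y `&` A)).
      rewrite hcsetE; [by move=> z []|apply: finite_set_countable].
      by apply: sub_finite_set fA => z [].
    rewrite -hcset_setU1; last by apply: sub_finite_set fA => z [].
    rewrite -[RHS]hcset_ext; congr hcset; apply/seteqP; split=> z; first by case=> [->|[]].
    by move=> yz; case: (yA z yz) => [->|Az]; [left|right].
  by left=> z yz; case: (yA z yz) => // zx; rewrite zx in yz.
by rewrite finite_setU; split=> //; exact: finite_image.
Qed.

(** * Definability of pairs, unions and inclusion *)

Section BasicNotions.
Variable M : HC.
Local Notation def := (definable M).
Local Notation term := (definable_term M).

Lemma term_hc0 : term (fun=> hc0).
Proof.
apply: (@def_ext _ (fun e => forall z, ~ z ∈ e 0)) => [e|]; last by definability.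
by rewrite HC_eqP; split=> H z; have := H z; have := @in_hc0 z; tauto.
Qed.

Lemma term_upair t s : term t -> term s -> term (fun e => upair (t e) (s e)).
Proof.
apply: term_app2.
apply: (@def_ext _ (fun e => forall z, z ∈ e 0 <-> z = e 1 \/ z = e 2)) => [e|].
  by rewrite HC_eqP; split=> H z; rewrite H in_upair.
definability.
Qed.

Lemma term_hunion t s : term t -> term s -> term (fun e => hunion (t e) (s e)).
Proof.
apply: term_app2.
apply: (@def_ext _ (fun e => forall z, z ∈ e 0 <-> z ∈ e 1 \/ z ∈ e 2)) => [e|].
  by rewrite HC_eqP; split=> H z; rewrite H in_hunion.
definability.
Qed.

Lemma term_opair t s : term t -> term s -> term (fun e => opair (t e) (s e)).
Proof.
move=> dt ds; have -> : (fun e => opair (t e) (s e)) =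
    (fun e => upair (upair (t e) (t e)) (upair (t e) (s e))).
  by apply: funext => e; rewrite opairE.
by do !apply: term_upair.
Qed.

Lemma term_hsucc t : term t -> term (fun e => hsucc (t e)).
Proof. by move=> dt; apply: term_hunion => //; apply: term_upair. Qed.

Lemma def_hsub t s : term t -> term s -> def (fun e => hsub (t e) (s e)).
Proof.
apply: def_app2; apply: (@def_ext _ (fun e => forall z, z ∈ e 0 -> z ∈ e 1)) => //.
definability.
Qed.

End BasicNotions.

Ltac set_notion ::=
  match goal with
  | |- definable_term _ (fun=> hc0) => exact: term_hc0
  | |- definable_term _ (fun e => upair (@?P e) (@?Q e)) => apply: term_upair
  | |- definable_term _ (fun e => opair (@?P e) (@?Q e)) => apply: term_opair
  | |- definable_term _ (fun e => hunion (@?P e) (@?Q e)) => apply: term_hunion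
  | |- definable_term _ (fun e => hsucc (@?P e)) => apply: term_hsucc
  | |- definable _ (fun e => hsub (@?P e) (@?Q e)) => apply: def_hsub
  end.

(** * Definability of numbers, finiteness and functions *)

Section FinitenessAndFunctions.
Variable M : HC.
Local Notation def := (definable M).
Local Notation term := (definable_term M).

(** Quantifiers over HC range over countable sets, so an inductive closure is first order: the set
    of all [num n] is countable and hence one of the values of [F]. *)
Lemma isnumP x : (exists n, x = num n) <->
  forall F, hc0 ∈ F -> (forall y, y ∈ F -> hsucc y ∈ F) -> x ∈ F.
Proof.
split=> [[n ->] F F0 FS|/(_ (hcset (range num)))].
  by elim: n => // n IH; rewrite numS; exact: FS.
have iF y : y ∈ hcset (range num) <-> exists n, y = num n.
  rewrite in_hcset; first by split=> [[n _ <-]|[n ->]]; exists n.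
  by apply: sub_countable (card_image_le _ _) _.
rewrite !iF; apply; first by exists 0.
by move=> y; rewrite !iF => -[n ->]; exists n.+1; rewrite numS.
Qed.

Lemma def_isnum t : term t -> def (fun e => exists n, t e = num n).
Proof.
apply: (@def_app1 _ (fun x => exists n, x = num n)).
apply: def_ext => [e|]; first by apply: iff_sym; exact: isnumP.
definability.
Qed.

(** Kuratowski finiteness: the finite subsets of [a] form a countable family, which is an admissible
    value of [F]. *)
Lemma finiteP a : finite_set (ext a) <->
  forall F, hc0 ∈ F -> (forall x y, x ∈ F -> y ∈ a -> hunion x (upair y y) ∈ F) -> a ∈ F.
Proof.
split=> [fa F F0 FS|/(_ (hcset [set x | ext x `<=` ext a /\ finite_set (ext x)]))].
  suff H A : finite_set A -> A `<=` ext a -> hcset A ∈ F.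
    by rewrite -[a]hcset_ext; exact: H.
  elim/finite_set_rect: A / => [|y A fA IH] Aa.
    by rewrite -ext0 hcset_ext.
  rewrite hcset_setU1 //; apply: FS; last by apply: Aa; left.
  by apply: IH => z Az; apply: Aa; right.
have cF : countable [set x | ext x `<=` ext a /\ finite_set (ext x)].
  exact/countable_finite_subsets/countable_ext.
rewrite !in_hcset //; case=> //.
  by split; rewrite ext0.
move=> x y; rewrite !in_hcset //= ext_hunion ext_upair setUid => -[xa fx] ya.
split; last by rewrite finite_setU.
by move=> z [/xa//|->].
Qed.

Lemma def_finite t : term t -> def (fun e => finite_set (ext (t e))).
Proof.
apply: (@def_app1 _ (fun x => finite_set (ext x))).
apply: def_ext => [e|]; first by apply: iff_sym; exact: finiteP.
definability.
Qed.

Lemma def_functional t : term t -> def (fun e => functional (t e)).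
Proof. by apply: (@def_app1 _ functional); rewrite /functional; definability. Qed.

Lemma def_dom t s : term t -> term s -> def (fun e => dom (t e) (s e)).
Proof. apply: (@def_app2 _ dom).
apply: (@def_ext _ (fun e => exists y, opair (e 1) y ∈ e 0)) => //.
definability. Qed.

Lemma term_num n : term (fun=> num n).
Proof. by elim: n => [|n IH]; [exact: term_hc0|rewrite numS; exact: term_hsucc]. Qed.

Lemma term_finite (A : set HC) :
  finite_set A -> (forall a, A a -> term (fun=> a)) -> term (fun=> hcset A).
Proof.
elim/finite_set_rect: A / => [|x A fA IH] tA.
  by rewrite -ext0 hcset_ext; exact: term_hc0.
rewrite hcset_setU1 //; apply: term_hunion; first by apply: IH => a Aa; apply: tA; right.
by apply: term_upair; apply: tA; left.
Qed.

End FinitenessAndFunctions.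

Ltac function_notion ::=
  match goal with
  | |- definable _ (fun e => exists n, @?P e = num n) => apply: def_isnum
  | |- definable _ (fun e => finite_set (ext (@?P e))) => apply: def_finite
  | |- definable _ (fun e => functional (@?P e)) => apply: def_functional
  | |- definable _ (fun e => dom (@?P e) (@?Q e)) => apply: def_dom
  | |- definable_term _ (fun=> num _) => apply: term_num
  end.

(** * Definable relations and the class [Mplus] *)

(** The default parameter [hc0] has to be listed among elements of [M]. Descending along membership
    ends in the empty set, and transitivity keeps the descent inside [M]. *)
Lemma transitive_hc0 M x : htransitive M -> x ∈ M -> hc0 ∈ M.
Proof.
move=> tM; elim/(well_founded_ind HC_wf): x => x IH xM.
have [<-//|] := pselect (x = hc0).
rewrite HC_eqP => /existsNP[y]; have := @in_hc0 y => y0 xy.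
have yx : y ∈ x by apply: contrapT => nyx; apply: xy; tauto.
by apply: (IH y yx); exact: (tM x xM y yx).
Qed.

Lemma Mplus_definable M X : Mplus M X -> definable M (fun e => e 0 ∈ X).
Proof.
move=> [f [ps [psM E]]].
exists (rename (fun n => if n is m.+1 then m.*2.+1 else 0) f), (nth hc0 ps).
split=> [n|e].
  have [nps|/(nth_default hc0)->] := ltnP n (size ps); last by right.
  by left; apply: psM; exact: mem_nth.
rewrite sat_rename.
have -> : interleave e (nth hc0 ps) \o (fun n => if n is m.+1 then m.*2.+1 else 0) =
          scons (e 0) (nth hc0 ps).
  apply: funext => -[|n] //=; rewrite /interleave /= odd_double /=.
  by rewrite uphalf_double.
by rewrite -[e 0 ∈ X]/(ext X (e 0)) E.
Qed.

Lemma definable_Mplus M (P : HC -> Prop) : htransitive M -> hc0 ∈ M ->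
  definable M (fun e => P (e 0)) -> countable [set x | P x] ->
  exists2 X, Mplus M X & ext X = [set x | P x].
Proof.
move=> tM M0 [f [p [pM fP]]] cP.
exists (hcset [set x | P x]); last by rewrite hcsetE.
pose g := rename (fun n => if odd n then n./2.+1 else 0) f.
have [N gN] := sat_local g.
exists g, (mkseq p N); split=> [a /mapP[n _ ->]|].
  by case: (pM n) => // ->.
rewrite hcsetE //; apply/seteqP; split=> x /=.
all: have -> : sat (scons x (nth hc0 (mkseq p N))) g <-> P x => //.
all: transitivity (sat (scons x p) g);
  first by apply: gN => -[|n] //= nN; rewrite nth_mkseq // ltnW.
all: rewrite sat_rename -(fP (fun=> x)).
all: suff -> : scons x p \o (fun n => if odd n then n./2.+1 else 0) =
               interleave (fun=> x) p by [].
all: by apply: funext => n; rewrite /interleave /=; case: (odd n).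
Qed.

(** * Finite strings *)

Lemma hsub_trans x y z : hsub x y -> hsub y z -> hsub x z.
Proof. exact: subset_trans. Qed.

Lemma hsub_refl x : hsub x x.
Proof. by []. Qed.

#[export] Hint Resolve hsub_refl : core.

Lemma hsub_antisym x y : hsub x y -> hsub y x -> x = y.
Proof. by move=> xy yx; apply: HC_ext; apply/seteqP; split. Qed.

Lemma in_restr x n z :
  z ∈ restr x n <-> exists2 i, i < n & opair (num i) (num (x i : bool)) = z.
Proof.
rewrite in_hcset; first by split=> -[i ? <-]; exists i.
by apply: sub_countable (card_image_le _ _) _.
Qed.

Lemma hsub_restr x m y n :
  hsub (restr x m) (restr y n) <-> m <= n /\ forall i, i < m -> x i = y i.
Proof.
split=> [sub|[mn xy] z].
  have H i : i < m -> i < n /\ x i = y i.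
    move=> im; have : opair (num i) (num (x i : bool)) ∈ restr y n.
      by apply: sub; rewrite /ext /= in_restr; exists i.
    rewrite in_restr => -[j jn /opair_inj[/num_inj ji /num_inj]].
    by rewrite -ji => xy; split=> //; move: xy; case: (x j : bool); case: (y j : bool).
  split=> [|i /H[]//]; case: m sub H => // m _ H.
  by have [] := H m (ltnSn m).
rewrite /ext /= !in_restr => -[i im <-]; exists i; first exact: leq_trans mn.
by rewrite xy.
Qed.

Lemma restrP s : strings s -> exists x n, s = restr x n.
Proof. by case=> n _ [x _ <-]; exists x, n. Qed.

Lemma lev_strings n s : strings_of_length n s -> strings s.
Proof. by exists n. Qed.

Lemma strings_lev s : strings s -> exists n, strings_of_length n s.
Proof. by case=> n _ ?; exists n. Qed.

Lemma lev_restr x n : strings_of_length n (restr x n).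
Proof. by exists x. Qed.

Lemma lev_hsub m n s t :
  strings_of_length m s -> strings_of_length n t -> hsub s t -> m <= n.
Proof. by move=> [x _ <-] [y _ <-] /hsub_restr[]. Qed.

Lemma lev_eq n s t :
  strings_of_length n s -> strings_of_length n t -> hsub s t -> s = t.
Proof.
move=> [x _ <-] [y _ <-] /hsub_restr[_ xy].
by apply: hsub_antisym; rewrite hsub_restr; split=> // i /xy.
Qed.

Lemma comparable_hsub m n s t : strings_of_length m s -> strings_of_length n t ->
  m <= n -> hsub s t \/ hsub t s -> hsub s t.
Proof.
move=> [x _ <-] [y _ <-] mn [//|/hsub_restr[nm yx]].
by rewrite hsub_restr; split=> // i im; rewrite yx // (leq_trans im).
Qed.

Lemma hsub_comparable r s t : strings r -> strings s -> strings t ->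
  hsub s r -> hsub t r -> hsub s t \/ hsub t s.
Proof.
move=> /restrP[x [n ->]] /restrP[y [m ->]] /restrP[z [k ->]].
rewrite !hsub_restr => -[_ yx] [_ zx].
have [mk|/ltnW km] := leqP m k; [left|right]; split=> // i im.
  by rewrite yx // zx // (leq_trans im).
by rewrite zx // yx // (leq_trans im).
Qed.

Lemma lev_truncate m n t : m <= n -> strings_of_length n t ->
  exists2 s, strings_of_length m s & hsub s t.
Proof.
move=> mn [x _ <-]; exists (restr x m); first exact: lev_restr.
by rewrite hsub_restr.
Qed.

Lemma dom_restr x n : dom (restr x n) = ext (num n).
Proof.
apply/seteqP; split=> z.
  by case=> y; rewrite in_restr => -[i im /opair_inj[<- _]]; rewrite /ext /= in_num; exists i.
rewrite /ext /= in_num => -[i im ->]; exists (num (x i : bool)).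
by rewrite in_restr; exists i.
Qed.

Lemma lev_dom s n : strings s ->
  strings_of_length n s <-> forall z, dom s z <-> z ∈ num n.
Proof.
case=> m _ [x _ <-]; rewrite dom_restr; split.
  move=> [y _ E]; have [nm _] := (hsub_restr y n x m).1 ltac:(by rewrite E).
  have [mn _] := (hsub_restr x m y n).1 ltac:(by rewrite E).
  by have -> : m = n by apply/eqP; rewrite eqn_leq mn nm.
move=> /HC_eqP /num_inj <-; exact: lev_restr.
Qed.

Lemma finite_level n : finite_set (strings_of_length n).
Proof.
apply: (@sub_finite_set _ _
  ((fun f : {ffun 'I_n -> bool} =>
      restr (fun i => if insub i is Some j then f j else false) n) @` setT)).
  move=> _ [x _ <-]; exists [ffun i : 'I_n => x i] => //.
  apply: hsub_antisym; rewrite hsub_restr; split=> // i im;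
    by rewrite insubT ffunE.
exact/finite_image/finite_finset.
Qed.

Lemma empty_string_hsub x s : hsub (restr x 0) s.
Proof. by move=> z; rewrite /ext /= in_restr => -[]. Qed.

(** * Perfect trees *)

Lemma perfect_strings T s : perfect_tree T -> s ∈ T -> strings s.
Proof. by case=> TS _ _ _ /TS. Qed.

Lemma perfect_down T s t :
  perfect_tree T -> t ∈ T -> strings s -> hsub s t -> s ∈ T.
Proof. by case=> _ _ dT _ tT; exact: dT. Qed.

(** Each of two incomparable extensions of [s] is properly longer than [s], so the distance to [n]
    decreases; an extension that overshoots [n] is truncated. *)
Lemma perfect_extend T s m n : perfect_tree T -> s ∈ T -> strings_of_length m s ->
  m <= n -> exists t, [/\ t ∈ T, strings_of_length n t & hsub s t].
Proof.
move=> pT; have [_ _ _ split_T] := pT.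
suff grow d : forall s m, s ∈ T -> strings_of_length m s -> n - m <= d -> m <= n ->
    exists t, [/\ t ∈ T, strings_of_length n t & hsub s t].
  by move=> sT ls mn; exact: (grow (n - m) s m).
elim: d => [|d IH] {}s {}m sT ls nmd mn.
  exists s; split=> //; suff -> : n = m by [].
  by apply/eqP; rewrite eqn_leq mn -subn_eq0 -leqn0 nmd.
have [nm|mltn] := leqP n m.
  by exists s; split=> //; suff -> : n = m by []; apply/eqP; rewrite eqn_leq mn nm.
have [t [k [tT lt st mk]]] : exists t k, [/\ t ∈ T, strings_of_length k t, hsub s t & m < k].
  have [t [t' [[tT t'T st st'] [ntt' nt't]]]] := split_T s sT.
  have [k lt] := strings_lev (perfect_strings pT tT).
  exists t, k; split=> //; rewrite ltn_neqAle (lev_hsub ls lt st) andbT.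
  apply/eqP => E; rewrite -E in lt; apply: ntt'.
  by rewrite -(lev_eq ls lt st).
have [kn|/ltnW nk] := leqP k n.
  have nkd : n - k <= d by rewrite -ltnS; apply: leq_trans nmd; rewrite ltn_sub2l.
  have [r [rT lr tr]] := IH t k tT lt nkd kn.
  by exists r; split=> //; exact: hsub_trans tr.
have [r lr rt] := lev_truncate nk lt.
exists r; split=> //; first exact: (perfect_down pT tT (lev_strings lr) rt).
apply: (comparable_hsub ls lr mn).
exact: (hsub_comparable (lev_strings lt) (lev_strings ls) (lev_strings lr) st rt).
Qed.

Lemma perfect_empty T x : perfect_tree T -> restr x 0 ∈ T.
Proof.
move=> pT; have [_ [s sT] _ _] := pT.
by apply: (perfect_down pT sT); [exists 0 => //; exact: lev_restr|exact: empty_string_hsub].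
Qed.

Lemma perfect_level T n : perfect_tree T -> exists2 s, s ∈ T & strings_of_length n s.
Proof.
move=> pT; have [s [sT ls _]] := perfect_extend pT
  (perfect_empty (fun=> false) pT) (lev_restr _ _) (leq0n n).
by exists s.
Qed.

Lemma in_cone T s t : t ∈ cone T s <-> t ∈ T /\ (hsub s t \/ hsub t s).
Proof.
by apply: in_hcset; apply: sub_countable (countable_ext T); apply: subset_card_le => r [].
Qed.

Lemma cone_hsub T s : hsub (cone T s) T.
Proof. by move=> t /in_cone[]. Qed.

Lemma cone_root T s : s ∈ T -> s ∈ cone T s.
Proof. by move=> sT; rewrite in_cone; split=> //; left. Qed.

Lemma cone_perfect T s : perfect_tree T -> s ∈ T -> perfect_tree (cone T s).
Proof.
move=> pT sT; have [TS T0 dT spT] := pT; split.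
- by move=> t /cone_hsub /TS.
- by exists s; exact: cone_root.
- move=> r t /in_cone[tT cst] sr rt; rewrite in_cone; split; first exact: dT rt.
  case: cst => [st|ts]; last by right; exact: hsub_trans ts.
  exact: hsub_comparable (TS _ tT) (TS _ sT) sr st rt.
- move=> r /in_cone[rT crs].
  have [r' [r'T sr' rr']] : exists r', [/\ r' ∈ T, hsub s r' & hsub r r'].
    by case: crs => [sr|rs]; [exists r; split|exists s; split].
  have [t [t' [[tT t'T r't r't'] inc]]] := spT r' r'T.
  exists t, t'; split=> //; split.
  - by rewrite in_cone; split=> //; left; exact: (hsub_trans sr' r't).
  - by rewrite in_cone; split=> //; left; exact: (hsub_trans sr' r't').
  - exact: (hsub_trans rr' r't).
  - exact: (hsub_trans rr' r't').
Qed.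

(** The longer of the two comparable nodes decides: [r] is [u] if [u] extends [s], and [s]
    otherwise. This closes the cones of a limit tree under further cones. *)
Lemma cone_cone T s u : perfect_tree T -> s ∈ T -> u ∈ cone T s ->
  exists2 r, r ∈ T & cone (cone T s) u = cone T r.
Proof.
move=> pT sT /in_cone[uT csu].
have S t : t ∈ T -> strings t := @perfect_strings T t pT.
case: csu => [su|us].
  exists u => //; apply/HC_eqP => t; rewrite !in_cone; split=> [[[]]//|[tT cut]].
  split=> //; split=> //; case: (cut) => [ut|tu]; first by left; exact: hsub_trans ut.
  by apply: (hsub_comparable (S _ uT)) => //; exact: S.
exists s => //; apply/HC_eqP => t; rewrite !in_cone; split=> [[[]]//|[tT cst]].
split; first by [].
case: cst => [st|ts]; first by left; exact: hsub_trans st.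
by apply: (hsub_comparable (S _ sT)) => //; exact: S.
Qed.

(** * Finite unions and fusion *)

Section FiniteUnions.
Variable P : set HC.
Hypothesis aP : arboreal P.

Lemma fin_unions_member T s : fin_unions P T -> s ∈ T ->
  exists S, [/\ P S, s ∈ S & hsub S T].
Proof.
move=> [Z [_ _ ZP TE]] sT; have : ext T s by [].
rewrite TE => -[S ZS sS]; exists S; split=> //; first exact: ZP.
by rewrite /hsub TE => r rS; exists S.
Qed.

Lemma fin_unions1 T : P T -> fin_unions P T.
Proof.
move=> PT; exists [set T]; split=> //; first by exists T.
  by move=> _ ->.
by rewrite bigcup_set1.
Qed.

Lemma fin_unions_perfect T : fin_unions P T -> perfect_tree T.
Proof.
move=> uT; have mem s := @fin_unions_member T s uT; have [pP _] := aP; split.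
- by move=> s /mem[S [/pP pS sS _]]; exact: perfect_strings pS sS.
- case: uT => [Z [_ [S ZS] ZP ->]]; have [_ [s sS] _ _] := pP S (ZP S ZS).
  by exists s; exists S.
- move=> s t /mem[S [/pP pS tS ST]] ss st; apply: ST.
  exact: perfect_down pS tS ss st.
- move=> s /mem[S [/pP [_ _ _ spS] sS ST]].
  have [t [t' [[tS t'S st st'] inc]]] := spS s sS.
  by exists t, t'; split=> //; split=> //; exact: ST.
Qed.

Lemma countable_fin_unions : countable P -> countable (fin_unions P).
Proof.
move=> /countable_finite_subset.
apply: (@sub_image_countable _ _ _ _ (fun Z => hcset (\bigcup_(S in Z) ext S))).
by move=> T [Z [fZ _ ZP TE]]; exists Z => //; rewrite -TE hcset_ext.
Qed.

(** [F] selects, at each node of level [n], a tree passing through it. *)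
Definition fuse (S : HC) (n : nat) (F : HC -> HC) : HC :=
  hcset (\bigcup_(s in [set s | s ∈ S /\ strings_of_length n s]) ext (F s)).

Lemma in_fuse S n F t :
  t ∈ fuse S n F <-> exists s, [/\ s ∈ S, strings_of_length n s & t ∈ F s].
Proof.
rewrite in_hcset; first by split=> [[s [sS ls] tF]|[s [sS ls tF]]]; exists s.
apply: bigcup_countable; last by move=> s _; exact: countable_ext.
by apply: sub_countable (countable_ext S); apply: subset_card_le => s [].
Qed.

(** In the cone at [s] the node [s] is the only one of level [n]. Hence any tree of [P] inside [F s]
    still passes through [s], which [selectors_dense] uses when it shrinks [F s]. *)
Definition fusible (S : HC) (n : nat) (F : HC -> HC) : Prop :=
  forall s, s ∈ S -> strings_of_length n s ->
    [/\ P (F s), s ∈ F s & hsub (F s) (cone S s)].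

Lemma fuse_fin_unions S n F :
  fin_unions P S -> fusible S n F -> fin_unions P (fuse S n F).
Proof.
move=> uS fF; exists (F @` [set s | s ∈ S /\ strings_of_length n s]); split.
- by apply: finite_image; apply: sub_finite_set (finite_level n) => s [].
- have [s sS ls] := perfect_level n (fin_unions_perfect uS).
  by exists (F s), s.
- by move=> _ [s [sS ls] <-]; have [] := fF s sS ls.
- rewrite bigcup_image; apply/seteqP; split=> t.
    by move=> /in_fuse[s [sS ls tF]]; exists s.
  by case=> s [sS ls] tF; apply/in_fuse; exists s.
Qed.

(** Trees are compared only at the level of the weaker condition, so the new number may be any [m]
    from [n] on. *)
Lemma fuse_le S n F m : fusible S n F -> n <= m -> tree_le m (fuse S n F) n S.
Proof.
move=> fF nm; have sub : hsub (fuse S n F) S.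
  by move=> t /in_fuse[s [sS ls tF]]; have [_ _ FS] := fF s sS ls; apply: cone_hsub (FS t tF).
split=> //; apply/seteqP; split=> t [tF lt]; split=> //; first exact: sub.
by apply/in_fuse; exists t; split=> //; have [] := fF t tF lt.
Qed.

(** The order asks for agreement at the single level [m]; shorter nodes survive because each extends
    to level [m] in a perfect tree. *)
Lemma tree_le_level n T m S k s : fin_unions P T -> fin_unions P S ->
  tree_le n T m S -> s ∈ S -> strings_of_length k s -> k <= m -> s ∈ T.
Proof.
move=> uT uS [_ _ E] sS ls km.
have [t [tS lt st]] := perfect_extend (fin_unions_perfect uS) sS ls km.
have : (ext S `&` strings_of_length m) t by [].
rewrite -E => -[tT _].
exact: (perfect_down (fin_unions_perfect uT) tT (lev_strings ls)).
Qed.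

End FiniteUnions.

Lemma select (A : set HC) (R : HC -> HC -> Prop) :
  (forall i, A i -> exists T, R i T) -> exists T, forall i, A i -> R i (T i).
Proof.
move=> AR; exists (fun i => xget hc0 [set T | R i T]) => i /AR[T RT].
by case: xgetP => // /(_ T).
Qed.

(** * Systems *)

Section Systems.
Variables M pi : HC.
Hypotheses (tM : htransitive M) (piM : pi ∈ M) (small_pi : small_multiforcing pi).

Let P xi := ext (app pi xi).

Lemma pi_functional : functional pi.
Proof. by have [[]] := small_pi. Qed.

Lemma pi_arboreal xi : dom pi xi -> arboreal (P xi).
Proof. by have [[_ _ +] _ _] := small_pi; apply. Qed.

Lemma mem_opair_param x y z : z ∈ M -> opair x y ∈ z -> x ∈ M /\ y ∈ M.
Proof.
move=> zM xyz; have xyM : opair x y ∈ M by exact: (tM zM xyz).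
have uM : upair x y ∈ M by apply: (tM xyM); rewrite /ext /= opairE in_upair; right.
by split; apply: (tM uM); rewrite /ext /= in_upair; [left|right].
Qed.

Lemma dom_param xi : dom pi xi -> xi ∈ M.
Proof. by case=> y /(mem_opair_param piM)[]. Qed.

Lemma tree_param xi T : dom pi xi -> P xi T -> T ∈ M.
Proof. by move=> /app_in /(mem_opair_param piM)[_ pM] /(tM pM). Qed.

Lemma term_index xi k : dom pi xi -> definable_term M (fun=> opair xi (num k)).
Proof.
move=> /dom_param xiM; apply: term_opair; first exact: term_param.
exact: term_num.
Qed.

(** The form that a formula can express: [app] becomes membership of pairs, numbers become elements
    of HC, and the finite family of trees is one element [Z]. *)
Lemma systemP phi : system pi phi <->
  functional phi /\ finite_set (ext phi) /\
  forall i T, opair i T ∈ phi -> exists xi k U Z,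
    (exists n, k = num n) /\ i = opair xi k /\ opair xi U ∈ pi /\
    finite_set (ext Z) /\ (exists S, S ∈ Z) /\ hsub Z U /\
    forall s, s ∈ T <-> exists S, S ∈ Z /\ s ∈ S.
Proof.
split=> [[fphi /functional_finite fin dphi uphi]|[fphi [/functional_finite fin H]]].
  split=> //; split=> [|i T iT]; first exact: fin.
  have /dphi[xi [k [xipi E]]] : dom phi i by exists T.
  have := uphi xi k; rewrite -E (app_eq fphi iT) => -[|Z [fZ [S ZS] ZP TE]].
    by exists T.
  exists xi, (num k), (app pi xi), (hcset Z).
  have cZ := finite_set_countable fZ.
  split; first by exists k.
  split=> //; split; first exact: app_in.
  rewrite hcsetE //; split=> //; split; first by exists S; rewrite in_hcset.
  split; first by rewrite /hsub hcsetE.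
  move=> s; rewrite -[s ∈ T]/(ext T s) TE.
  by split=> [[S' ? ?]|[S' []]]; exists S'; rewrite ?in_hcset // -(in_hcset _ cZ).
split=> //; first exact: fin.
  move=> i [T /H[xi [_ [U [Z [[k ->] [-> [xiU _]]]]]]]].
  by exists xi, k; split=> //; exists U.
move=> xi k [T /[dup] iT].
move=> /H[xi' [_ [U [Z [[k' ->] [/opair_inj[<- _] [xiU [fZ [[S SZ] [ZU TE]]]]]]]]]].
rewrite (app_eq fphi iT) (app_eq pi_functional xiU).
exists (ext Z); split=> //; first by exists S.
apply/seteqP; split=> s; rewrite /ext /= TE => -[S']; last by exists S'.
by case; exists S'.
Qed.

Lemma def_system t : definable_term M t -> definable M (fun e => system pi (t e)).
Proof.
apply: (@def_app1 _ (system pi)).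
apply: def_ext => [e|]; first by apply: iff_sym; exact: systemP.
have tpi := term_param piM.
definability.
Qed.

(** A system is a finite subset of a countable stock of pairs of an index and a finite union.
    Countability is what lets a set of conditions be coded in HC. *)
Lemma countable_systems : countable [set phi | system pi phi].
Proof.
have [_ cpi cP] := small_pi.
pose A := (fun w => opair (opair w.1.1 (num w.1.2)) w.2) @`
  [set w : HC * nat * HC | dom pi w.1.1 /\ fin_unions (P w.1.1) w.2].
have cA : countable A.
  apply: (@sub_image_countable _ _ _
    (\bigcup_(xi in dom pi) [set w : HC * nat * HC | w.1.1 = xi /\ fin_unions (P xi) w.2])
    (fun w => opair (opair w.1.1 (num w.1.2)) w.2)).
    by move=> _ [w [w1 w2] <-]; exists w => //; exists w.1.1.
  apply: bigcup_countable => // xi xipi.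
  apply: (@sub_image_countable _ _ _ (setT `*` fin_unions (P xi))
    (fun w : nat * HC => (xi, w.1, w.2))).
    by move=> [[x k] T] [/= -> uT]; exists (k, T).
  by apply: countableX => //; apply: countable_fin_unions; exact: cP.
apply: (@sub_image_countable _ _ _ _ id); last exact: (countable_finite_subsets cA).
move=> phi sphi; exists phi => //; split; last by have /systemP[_ []] := sphi.
have [fphi _ dphi uphi] := sphi.
move=> z /(in_functional _ fphi)[i iphi ->].
have [xi [k [xipi E]]] := dphi i iphi; subst i.
by exists (xi, k, app phi (opair xi (num k))) => //; split=> //; exact: uphi.
Qed.

Lemma coded_systems (R : HC -> HC -> Prop) :
  definable M (fun e => R (e 0) (e 1)) ->
  coded_in (Mplus M) [set z | system pi z.2 /\ R (num z.1) z.2].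
Proof.
move=> dR.
pose Q x := exists n phi, (exists m, n = num m) /\ x = opair n phi /\ system pi phi /\ R n phi.
have QE : [set x | Q x] = code @` [set z | system pi z.2 /\ R (num z.1) z.2].
  apply/seteqP; split=> x; first by move=> [_ [phi [[m ->] [-> H]]]]; exists (m, phi).
  by move=> [[m phi] H <-]; exists (num m), phi; split=> //; exists m.
suff [X MX XE] : exists2 X, Mplus M X & ext X = [set x | Q x].
  by exists X => //; rewrite XE.
apply: definable_Mplus => //; first exact: transitive_hc0 piM.
  do 2!apply: def_ex; apply: def_and; first by definability.
  apply: def_and; first by definability.
  apply: def_and; first by apply: def_system; exact: term_var.
  exact: (def_rename (fun n => 1 - n) dR).
rewrite QE; apply: (@sub_image_countable _ _ _ ([set: nat] `*` [set phi | system pi phi]) code).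
  by move=> _ [[m phi] [sphi _] <-]; exists (m, phi).
by apply: countableX => //; exact: countable_systems.
Qed.

Lemma system_index phi i : system pi phi -> dom phi i -> exists xi k,
  [/\ dom pi xi, i = opair xi (num k) & fin_unions (P xi) (app phi i)].
Proof.
move=> [_ _ dphi uphi] di; have [xi [k [xipi E]]] := dphi i di.
by exists xi, k; split=> //; rewrite E; apply: uphi; rewrite -E.
Qed.

Lemma update_system phi (A : set HC) (G : HC -> HC) n n' :
  system pi phi -> finite_set A -> dom phi `<=` A -> n <= n' ->
  (forall i, A i -> exists xi k,
     [/\ dom pi xi, i = opair xi (num k) & fin_unions (P xi) (G i)]) ->
  (forall i, dom phi i -> tree_le n' (G i) n (app phi i)) ->
  system pi (mkfun A G) /\ system_le (n', mkfun A G) (n, phi).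
Proof.
move=> sphi fA phiA nn' AG Gle; have cA := finite_set_countable fA.
split; split; rewrite ?dom_mkfun //=.
- exact: mkfun_functional.
- by move=> i /AG[xi [k []]]; exists xi, k.
- move=> xi k Ai; rewrite app_mkfun //.
  by have [xi' [k' [_ /opair_inj[<- _]]]] := AG _ Ai.
- by move=> i di; rewrite app_mkfun //; [exact: Gle|exact: phiA].
Qed.

(** The order puts no constraint on new indices, so any tree of [P xi] serves there and the number
    [n] stays; an empty forcing would offer no tree. *)
Lemma extend_system phi n (K : set HC) : system pi phi -> finite_set K ->
  (forall i, K i -> exists xi k, [/\ dom pi xi, i = opair xi (num k) & P xi !=set0]) ->
  exists phi', [/\ system pi phi', system_le (n, phi') (n, phi) & K `<=` dom phi'].
Proof.
move=> sphi fK KP; have [_ fphi _ _] := sphi.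
have fA : finite_set (dom phi `|` K) by rewrite finite_setU.
have [T TP] : exists T : HC -> HC, forall i, K i ->
    exists xi k, [/\ dom pi xi, i = opair xi (num k) & P xi (T i)].
  apply: (select (R := fun i T => exists xi k,
    [/\ dom pi xi, i = opair xi (num k) & P xi T])) => i /KP[xi [k [xipi E [T PT]]]].
  by exists T, xi, k.
pose G i := if pselect (dom phi i) then app phi i else T i.
have [|i di|sG leG] := @update_system phi _ G n n sphi fA (@subsetUl _ _ _) (leqnn n).
- move=> i; rewrite /G; case: pselect => [di _|ndi []// /TP[xi [k [xipi E PT]]]].
    exact: system_index.
  by exists xi, k; split=> //; exact: fin_unions1.
- by rewrite /G; case: pselect.
exists (mkfun (dom phi `|` K) G); split=> //.
by rewrite dom_mkfun; [exact: subsetUr|exact: finite_set_countable].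
Qed.

End Systems.

(** * Fusion through chosen nodes *)

Lemma finite_bound (A : set HC) (g : HC -> nat) :
  finite_set A -> exists N, forall a, A a -> g a <= N.
Proof.
elim/finite_set_rect: A / => [|x A _ [N AN]]; first by exists 0.
exists (maxn (g x) N) => a [->|/AN aN]; first exact: leq_maxl.
exact: leq_trans aN (leq_maxr _ _).
Qed.

(** The density tool for a single tree: above each [s] of level [n] the new tree is squeezed through
    a chosen [r]. Since [m] bounds the lengths of all these [r], every node of level [m] extends the
    [r] of its [s]. *)
Lemma fuse_choice P S n (Phi : HC -> HC -> Prop) : arboreal P -> fin_unions P S ->
  (forall s, s ∈ S -> strings_of_length n s -> exists r, [/\ r ∈ S, hsub s r & Phi s r]) ->
  exists m S', [/\ n <= m, fin_unions P S', tree_le m S' n S &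
    forall s', s' ∈ S' -> strings_of_length m s' ->
      exists s r, [/\ r ∈ S, strings_of_length n s, hsub s r, hsub r s' & Phi s r]].
Proof.
move=> aP uS SPhi; have pS := fin_unions_perfect aP uS.
have [r rP] : exists r : HC -> HC, forall s, s ∈ S /\ strings_of_length n s ->
    [/\ r s ∈ S, hsub s (r s) & Phi s (r s)].
  apply: (select (A := [set s | s ∈ S /\ strings_of_length n s])
    (R := fun s r => [/\ r ∈ S, hsub s r & Phi s r])) => s [sS ls].
  by have [r ?] := SPhi s sS ls; exists r.
have [F FP] : exists F : HC -> HC, forall t, t ∈ S -> [/\ P (F t), t ∈ F t & hsub (F t) S].
  apply: (select (A := ext S) (R := fun t F => [/\ P F, t ∈ F & hsub F S])) => t tS.
  exact: fin_unions_member.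
(* The cone is taken in one tree of [P] through [r s], not in [S], so that it is again a member of
   [P]. *)
have fusF : fusible P S n (fun s => cone (F (r s)) (r s)).
  move=> s sS ls; have [rS sr _] := rP s (conj sS ls).
  have [PF rF FS] := FP (r s) rS; have ss := lev_strings ls.
  have pF := aP.1 _ PF.
  split; first exact: aP.2.
    by rewrite in_cone; split; [exact: perfect_down pF rF ss sr|right].
  move=> t /in_cone[tF crt]; rewrite /ext /= in_cone; split; first exact: FS.
  case: crt => [rt|tr]; first by left; exact: hsub_trans rt.
  exact: (hsub_comparable (perfect_strings pF rF) ss (perfect_strings pF tF) sr tr).
have [len lenP] : exists len : HC -> nat, forall t, strings t -> strings_of_length (len t) t.
  exists (fun t => xget 0 [set k | strings_of_length k t]) => t /strings_lev[k lk].
  by case: xgetP => // /(_ k).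
have fA : finite_set [set s | s ∈ S /\ strings_of_length n s].
  by apply: sub_finite_set (finite_level n) => s [].
have [N rN] := finite_bound (len \o r) fA.
have nm : n <= maxn n N := leq_maxl _ _.
exists (maxn n N), (fuse S n (fun s => cone (F (r s)) (r s))); split=> //.
- exact: fuse_fin_unions.
- exact: (fuse_le fusF nm).
move=> s' /in_fuse[s [sS ls /in_cone[s'F crs]]] ls'; exists s, (r s).
have [rS sr Phis] := rP s (conj sS ls); split=> //.
apply: (comparable_hsub (lenP _ (perfect_strings pS rS)) ls') crs.
by apply: leq_trans (leq_maxr _ _); apply: rN.
Qed.

(** * The order on conditions *)

Section Order.
Variable pi : HC.
Hypothesis small_pi : small_multiforcing pi.

Lemma system_le_refl w : system_le w w.
Proof. by split=> // i _; split. Qed.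

(** The trees of [z] and [w] agree at level [w.1], but agreement is needed at the lower level [v.1];
    [tree_le_level] transfers it, which is why both must be systems. *)
Lemma system_le_trans z w v : system pi z.2 -> system pi w.2 ->
  system_le z w -> system_le w v -> system_le z v.
Proof.
move=> sz sw [wz dwz lewz] [vw dvw levw]; split; first exact: leq_trans wz.
  exact: subset_trans dwz.
move=> i vi; have wi := dvw i vi; have zi := dwz i wi.
have [xi [k [xipi E uw]]] := system_index sw wi.
have uz : fin_unions (ext (app pi xi)) (app z.2 i).
  by have [_ _ _ u] := sz; rewrite E; apply: u; rewrite -E.
have aP := pi_arboreal small_pi xipi.
have [_ zw_sub zw_lev] := lewz i wi; have [_ wv_sub wv_lev] := levw i vi.
split; first exact: leq_trans wz.
  exact: hsub_trans wv_sub.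
rewrite -wv_lev; apply/seteqP; split=> t [tT lt]; split=> //; first exact: zw_sub.
exact: (tree_le_level aP uz uw (lewz i wi) tT lt).
Qed.

End Order.

(** * Generic sequences *)

Section Generic.
Variables (M pi : HC) (z : nat -> nat * HC).
Hypotheses (tM : htransitive M) (piM : pi ∈ M) (small_pi : small_multiforcing pi).
Hypothesis gen : generic_sequence M pi z.

Let P xi := ext (app pi xi).

Lemma gen_system j : system pi (z j).2.
Proof. by have [sz _ _ _] := gen; exact: sz. Qed.

Lemma gen_decreasing i j : i <= j -> system_le (z j) (z i).
Proof.
have [_ dz _ _] := gen; elim: j => [|j IH].
  by rewrite leqn0 => /eqP->; exact: system_le_refl.
rewrite leq_eqVlt => /orP[/eqP->|/IH]; first exact: system_le_refl.
exact: (system_le_trans small_pi (gen_system _) (gen_system _) (dz j)).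
Qed.

Lemma gen_dom i j x : i <= j -> dom (z i).2 x -> dom (z j).2 x.
Proof. by move=> /gen_decreasing[_ d _] /d. Qed.

Lemma gen_meet (R : HC -> HC -> Prop) : definable M (fun e => R (e 0) (e 1)) ->
  (forall n phi, system pi phi -> exists m phi',
     [/\ system pi phi', system_le (m, phi') (n, phi) & R (num m) phi']) ->
  (forall n phi m phi', system pi phi -> R (num n) phi -> system pi phi' ->
     system_le (m, phi') (n, phi) -> R (num m) phi') ->
  exists j, R (num (z j).1) (z j).2.
Proof.
move=> dR denseR openR; have [_ _ _ meet] := gen.
have [|j []] := meet _ _ (coded_systems tM piM small_pi dR); last by exists j.
split.
- by move=> w [].
- move=> [n phi] sphi; have [m [phi' [sphi' le R']]] := denseR n phi sphi.
  by exists (m, phi').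
- move=> [n phi] [m phi'] [sphi Rphi] sphi' le; split=> //.
  exact: openR le.
Qed.

(** Genericity at one index. The remaining trees are left unchanged when the number grows to [m],
    which is allowed because the order compares only at the old level. *)
Lemma gen_meet1 xi k (R : HC -> HC -> Prop) : dom pi xi -> P xi !=set0 ->
  definable M (fun e => R (e 0) (e 1)) ->
  (forall n S, fin_unions (P xi) S -> exists m S',
     [/\ n <= m, fin_unions (P xi) S', tree_le m S' n S & R (num m) S']) ->
  (forall n S m S', fin_unions (P xi) S -> fin_unions (P xi) S' ->
     R (num n) S -> tree_le m S' n S -> R (num m) S') ->
  exists2 j, dom (z j).2 (opair xi (num k)) &
             R (num (z j).1) (app (z j).2 (opair xi (num k))).
Proof.
move=> xipi P0 dR denseR openR; set i := opair xi (num k).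
suff [j [S [iS RS]]] : exists j S, opair i S ∈ (z j).2 /\ R (num (z j).1) S.
  exists j; first by exists S.
  by have [fz _ _ _] := gen_system j; rewrite (app_eq fz iS).
have uP phi : system pi phi -> dom phi i -> fin_unions (P xi) (app phi i).
  by move=> sphi /(system_index sphi)[xi' [k' [_ /opair_inj[<- _]]]].
apply: (gen_meet (R := fun n phi => exists S, opair i S ∈ phi /\ R n S)).
- have ti := term_index tM piM k xipi.
  apply: def_ex; apply: def_and; first by definability; exact: ti.
  exact: (def_rename (fun n => if n is 0 then 1 else 0) dR).
- move=> n phi sphi.
  have fi : finite_set [set i] by exact: finite_set1.
  have [|phi1 [sphi1 le1 iphi1]] := @extend_system pi phi n _ sphi fi.
    by move=> _ ->; exists xi, k.
  have {}iphi1 : dom phi1 i by exact: iphi1.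
  have [m [S [nm uS leS RS]]] := denseR n _ (uP _ sphi1 iphi1).
  pose G x := if x == i then S else app phi1 x.
  have [_ fphi1 _ _] := sphi1.
  have [||sG leG] := @update_system pi phi1 (dom phi1) G n m sphi1 fphi1 (@subset_refl _ _) nm.
  + move=> x dx; rewrite /G; case: eqP => [->|_]; first by exists xi, k.
    exact: system_index.
  + by move=> x dx; rewrite /G; case: eqP => [->//|_]; split.
  exists m, (mkfun (dom phi1) G); split=> //.
    exact: (@system_le_trans pi small_pi (m, _) (n, phi1) (n, phi) sG sphi1 leG le1).
  exists S; split=> //; rewrite pair_in_mkfun; last exact: finite_set_countable.
  by split=> //; rewrite /G eqxx.
- move=> n phi m phi' sphi [S [iS RS]] sphi' [_ dphi lephi].
  have di : dom phi i by exists S.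
  have [fphi _ _ _] := sphi.
  exists (app phi' i); split; first by apply: app_in; exact: dphi.
  apply: openR RS _; rewrite -?(app_eq fphi iS); last exact: lephi.
    exact: uP.
  by apply: uP => //; exact: dphi.
Qed.

Lemma gen_below xi T : dom pi xi -> P xi T -> exists j k,
  dom (z j).2 (opair xi (num k)) /\ hsub (app (z j).2 (opair xi (num k))) T.
Proof.
move=> xipi PT.
(* Here [k] ranges over HC, as formulas require; being an index of a system makes it a number
   afterwards. *)
have [j [k [S [iS ST]]]] : exists j k S, opair (opair xi k) S ∈ (z j).2 /\ hsub S T.
  apply: (gen_meet (R := fun n phi => exists k S, opair (opair xi k) S ∈ phi /\ hsub S T)).
  - have txi := term_param (dom_param tM piM xipi).
    have tT := term_param (tree_param tM piM xipi PT).
    by definability.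
  - move=> n phi sphi; have [_ fphi _ _] := sphi.
    (* The domain is finite, so some number is fresh, and [T] itself can be placed there. *)
    have [k nk] : exists k, ~ dom phi (opair xi (num k)).
      apply: contrapT => /forallNP H; apply: infinite_nat.
      apply: sub_finite_set (finite_preimage (f := fun k => opair xi (num k)) _ fphi).
        by move=> k _; apply: contrapT => /H.
      by move=> k k' _ _ /opair_inj[_ /num_inj].
    pose A := dom phi `|` [set opair xi (num k)].
    pose G x := if x == opair xi (num k) then T else app phi x.
    have fA : finite_set A by rewrite finite_setU.
    have [||sG leG] := @update_system pi phi A G n n sphi fA (@subsetUl _ _ _) (leqnn n).
    + move=> x dx; rewrite /G; case: eqP => [->|nx].
        by exists xi, k; split=> //; exact: fin_unions1.
      by case: dx => // dx; exact: system_index.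
    + by move=> x dx; rewrite /G; case: eqP => [E|_]; [case: nk; rewrite -E|split].
    exists n, (mkfun A G); split=> //; exists (num k), T; split=> //.
    rewrite pair_in_mkfun; last exact: finite_set_countable.
    by split; [right|rewrite /G eqxx].
  - move=> n phi m phi' sphi [k [S [iS ST]]] sphi' [_ dphi lephi].
    have di : dom phi (opair xi k) by exists S.
    have [fphi _ _ _] := sphi; have [_ sub _] := lephi _ di.
    exists k, (app phi' (opair xi k)); split; first by apply: app_in; exact: dphi.
    by apply: hsub_trans ST; rewrite -(app_eq fphi iS).
have [fz _ _ _] := gen_system j.
have [xi' [k' [_ /opair_inj[_ E] _]]] := system_index (gen_system j) (ex_intro _ S iS).
by subst k; exists j, k'; split; [exists S|rewrite (app_eq fz iS)].
Qed.

End Generic.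

(** First-order stand-in for [strings_of_length]: the length is an element of HC, and a string of
    length [num n] has domain [num n]. *)
Definition has_length (s n : HC) : Prop := forall x, dom s x <-> x ∈ n.

Lemma has_lengthP s n : strings s -> has_length s (num n) <-> strings_of_length n s.
Proof. by move=> ss; apply: iff_sym; exact: lev_dom. Qed.

(** The complement has the same form, so openness of such sets suffices; they are unions of
    cylinders. *)
Lemma clopen_initial (n : nat) (Q : HC -> Prop) :
  clopen [set x : cantor_space | Q (restr x n)].
Proof.
have opn (R : HC -> Prop) : open [set x : cantor_space | R (restr x n)].
  have cyl m (x : cantor_space) : open [set y : cantor_space | forall i, i < m -> y i = x i].
    elim: m => [|m IH].
      by rewrite (_ : [set y | _] = setT); [exact: openT|apply/seteqP; split].
    rewrite (_ : [set y | _] = [set y : cantor_space | forall i, i < m -> y i = x i] `&`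
        (proj m @^-1` [set x m])).
      apply: openI => //; apply: open_comp; last exact: discrete_open.
      by move=> y _; exact: proj_continuous.
    apply/seteqP; split=> [y H|y [H1 H2] i].
      by split=> [i im|]; [apply: H; rewrite ltnS ltnW|rewrite /proj /=; exact: H].
    by rewrite ltnS leq_eqVlt => /orP[/eqP->|/H1].
  rewrite (_ : [set x | _] = \bigcup_(x in [set x : cantor_space | R (restr x n)])
      [set y : cantor_space | forall i, i < n -> y i = x i]).
    by apply: bigcup_open => x _; exact: cyl.
  apply/seteqP; split=> [y Ry|y [x Rx yx]]; first by exists y.
  rewrite /= (_ : restr y n = restr x n) //.
  by apply: hsub_antisym; rewrite hsub_restr; split=> // i /yx.
split; first exact: opn.
by rewrite -openC; exact: (opn (fun s => ~ Q s)).
Qed.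

(** * Limit trees of a generic sequence *)

Section Limit.
Variables (M pi : HC) (z : nat -> nat * HC).
Hypotheses (tM : htransitive M) (piM : pi ∈ M) (small_pi : small_multiforcing pi).
Hypothesis gen : generic_sequence M pi z.

Let P xi := ext (app pi xi).
Local Notation Q := (limit_tree z).
Local Notation approx j xi k := (app (z j).2 (opair xi (num k))).
Local Notation active j xi k := (dom (z j).2 (opair xi (num k))).

Lemma approx_fin_unions j xi k : active j xi k ->
  dom pi xi /\ fin_unions (P xi) (approx j xi k).
Proof.
move=> a; have := system_index (gen_system gen j) a.
by move=> [xi' [k' [xipi /opair_inj[E _]]]]; subst xi'.
Qed.

Lemma approx_le i j xi k : i <= j -> active i xi k ->
  tree_le (z j).1 (approx j xi k) (z i).1 (approx i xi k).
Proof. by move=> /(gen_decreasing small_pi gen)[_ _ H] /H. Qed.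

Lemma in_limit xi k s : s ∈ Q xi k <-> exists j0, forall j, j0 <= j ->
  active j xi k /\ s ∈ approx j xi k.
Proof.
rewrite in_hcset.
  split=> [[j0 [H1 H2]]|[j0 H]]; exists j0; first by move=> j jj; auto.
  by split=> j /H[].
apply: (@sub_countable _ _ _ (\bigcup_j ext (approx j xi k))).
  by apply: subset_card_le => t [j0 [_ H]]; exists j0 => //; exact: H.
by apply: bigcup_countable => // j _; exact: countable_ext.
Qed.

Lemma limit_hsub j xi k : active j xi k -> hsub (Q xi k) (approx j xi k).
Proof.
move=> a s /in_limit[j0 H]; have [_ sub _] := approx_le (leq_maxl j j0) a.
by apply: sub; have [] := H _ (leq_maxr j j0).
Qed.

Lemma limit_active xi k s : s ∈ Q xi k -> exists j, active j xi k.
Proof. by move=> /in_limit[j0 H]; exists j0; have [] := H j0 (leqnn _). Qed.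

(** From stage [j] on, nodes of length at most [(z j).1] are frozen. This carries facts about an
    approximation over to the limit. *)
Lemma limit_level j xi k s m : active j xi k -> s ∈ approx j xi k ->
  strings_of_length m s -> m <= (z j).1 -> s ∈ Q xi k.
Proof.
move=> a sA ls mz; apply/in_limit; exists j => i ji.
have ai := gen_dom small_pi gen ji a.
have [xipi uj] := approx_fin_unions a; have [_ ui] := approx_fin_unions ai.
split=> //.
exact: (tree_le_level (pi_arboreal small_pi xipi) ui uj (approx_le ji a) sA ls).
Qed.

Lemma active_nonempty j xi k : active j xi k -> P xi !=set0.
Proof. by move=> /approx_fin_unions[_ [Z [_ [S ZS] ZP _]]]; exists S; exact: ZP. Qed.

Lemma gen_meet_active i xi k (R : HC -> HC -> Prop) : active i xi k ->
  definable M (fun e => R (e 0) (e 1)) ->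
  (forall n S, fin_unions (P xi) S -> exists m S',
     [/\ n <= m, fin_unions (P xi) S', tree_le m S' n S & R (num m) S']) ->
  (forall n S m S', fin_unions (P xi) S -> fin_unions (P xi) S' ->
     R (num n) S -> tree_le m S' n S -> R (num m) S') ->
  exists2 j, active j xi k & R (num (z j).1) (approx j xi k).
Proof.
move=> a; have [xipi _] := approx_fin_unions a.
exact: (gen_meet1 tM piM small_pi gen k xipi (active_nonempty a)).
Qed.

Lemma limit_splits i xi k s : active i xi k -> s ∈ Q xi k -> exists t t',
  [/\ t ∈ Q xi k, t' ∈ Q xi k, hsub s t & hsub s t'] /\ ~ hsub t t' /\ ~ hsub t' t.
Proof.
move=> a sQ; have [xipi ui] := approx_fin_unions a.
have aP := pi_arboreal small_pi xipi.
have [l ls] := strings_lev (perfect_strings (fin_unions_perfect aP ui) (limit_hsub a sQ)).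
(* The two extensions are required at the length given by the number of the condition: there they
   are frozen and survive in the limit. At equal length, distinct means incomparable. *)
pose R n S := s ∈ S -> exists t t', t ∈ S /\ t' ∈ S /\ hsub s t /\ hsub s t' /\
  ~ (t = t') /\ has_length t n /\ has_length t' n.
have RE n S : fin_unions (P xi) S -> R (num n) S <-> (s ∈ S -> exists t t',
    [/\ t ∈ S, t' ∈ S, hsub s t & hsub s t'] /\
    [/\ t <> t', strings_of_length n t & strings_of_length n t']).
  move=> uS; have strS t := @perfect_strings S t (fin_unions_perfect aP uS).
  split=> H /H[t [t']].
    move=> [tS [t'S [st [st' [tt' [+ +]]]]]]; rewrite !has_lengthP; try exact: strS.
    by exists t, t'.
  move=> [[tS t'S st st'] [tt' lt lt']]; exists t, t'; do 5!split=> //.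
  by rewrite !has_lengthP; [split|exact: strS|exact: strS].
have [|n S uS|n S m S' uS uS'|j aj] := @gen_meet_active i xi k R a.
- have ts : definable_term M (fun=> s).
    have [x _ <-] := ls; apply: term_finite.
      by apply: finite_image; exact: finite_II.
    by move=> _ [n _ <-]; definability.
  by rewrite /R /has_length; definability.
- have pS := fin_unions_perfect aP uS.
  have [sS|nsS] := pselect (s ∈ S); last first.
    by exists n, S; split=> //; rewrite RE.
  have [_ _ _ /(_ s sS)[t [t' [[tS t'S st st'] [ntt' nt't]]]]] := pS.
  have [c lt] := strings_lev (perfect_strings pS tS).
  have [d lt'] := strings_lev (perfect_strings pS t'S).
  (* [S] already splits above [s]; only the number has to grow until the splitting is visible at its
     level. *)
  pose m := maxn n (maxn c d).
  have cm : c <= m by rewrite !leq_max leqnn orbT.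
  have dm : d <= m by rewrite !leq_max leqnn !orbT.
  have [r [rS lr tr]] := perfect_extend pS tS lt cm.
  have [r' [r'S lr' tr']] := perfect_extend pS t'S lt' dm.
  exists m, S; split=> //; try by rewrite leq_maxl.
    by split=> //; rewrite leq_maxl.
  have sr := hsub_trans st tr; have sr' := hsub_trans st' tr'.
  rewrite RE // => _; exists r, r'; do 2!split=> //; move=> E; subst r'.
  by have [] := hsub_comparable (lev_strings lr) (lev_strings lt) (lev_strings lt') tr tr'.
- rewrite !RE // => H le sS'; have [nm sub lev] := le.
  have pS' := fin_unions_perfect aP uS'.
  have [t [t' [[tS t'S st st'] [ntt' lt lt']]]] := H (sub _ sS').
  have tS' := tree_le_level aP uS' uS le tS lt (leqnn n).
  have t'S' := tree_le_level aP uS' uS le t'S lt' (leqnn n).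
  have [r [rS lr tr]] := perfect_extend pS' tS' lt nm.
  have [r' [r'S lr' tr']] := perfect_extend pS' t'S' lt' nm.
  have sr := hsub_trans st tr; have sr' := hsub_trans st' tr'.
  exists r, r'; do 2!split=> //; move=> E; subst r'; apply: ntt'.
  have [tt'|t't] := hsub_comparable (lev_strings lr) (lev_strings lt) (lev_strings lt') tr tr'.
    exact: lev_eq lt lt' tt'.
  by apply: esym; exact: lev_eq lt' lt t't.
have [_ uj] := approx_fin_unions aj.
rewrite RE // => /(_ (limit_hsub aj sQ))[t [t' [[tS t'S st st'] [ntt' lt lt']]]].
have tQ := limit_level aj tS lt (leqnn _).
have t'Q := limit_level aj t'S lt' (leqnn _).
exists t, t'; split; first by [].
by split=> H; apply: ntt'; [exact: lev_eq lt lt' H|apply: esym; exact: lev_eq lt' lt H].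
Qed.

Lemma limit_perfect i xi k : active i xi k -> perfect_tree (Q xi k).
Proof.
move=> a; have [xipi ui] := approx_fin_unions a.
have aP := pi_arboreal small_pi xipi; have pA := fin_unions_perfect aP ui.
split.
- by move=> s /(limit_hsub a); exact: perfect_strings.
- exists (restr (fun=> false) 0).
  by apply: (limit_level a (perfect_empty _ pA) (lev_restr _ _)).
- move=> s t /in_limit[j0 H] ss st; apply/in_limit; exists j0 => j /H[aj tA].
  have [_ uj] := approx_fin_unions aj.
  by split=> //; exact: (perfect_down (fin_unions_perfect aP uj) tA ss st).
- by move=> s; exact: limit_splits a.
Qed.

(** If [S] still contains [T], take a node [t0] of [T] of level [n] and two incomparable extensions
    [t], [t'] in [T]. Squeezing [S] through [t] above [t0] removes [t']. *)
Lemma limit_not_above i xi k T : active i xi k -> P xi T -> ~ hsub T (Q xi k).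
Proof.
move=> a PT; have [xipi _] := approx_fin_unions a.
have aP := pi_arboreal small_pi xipi; have pT := aP.1 _ PT.
pose R (n S : HC) := exists t, t ∈ T /\ ~ t ∈ S.
have [|n S uS|n S m S' uS uS' [t [tT tS]] [_ sub _]|j aj] := @gen_meet_active i xi k R a.
- have tT := term_param (tree_param tM piM xipi PT).
  by rewrite /R; definability.
- have pS := fin_unions_perfect aP uS.
  have [TS|] := pselect (hsub T S); last first.
    by move=> /existsNP[t /not_implyP tS]; exists n, S; split=> //; exists t.
  have [t0 t0T lt0] := perfect_level n pT.
  have [_ _ _ /(_ t0 t0T)[t [t' [[tT t'T t0t t0t'] [ntt' nt't]]]]] := pT.
  have [s sS ls|m [S' [nm uS' leS' HS']]] :=
    @fuse_choice _ S n (fun s r => s = t0 -> r = t) aP uS.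
    have [->|ne] := pselect (s = t0); last by exists s; split.
    by exists t; split=> //; exact: TS.
  exists m, S'; split=> //; exists t'; split=> // t'S'.
  have pS' := fin_unions_perfect aP uS'.
  have [d lt'] := strings_lev (perfect_strings pS' t'S').
  (* [w] extends both [t'] and a node [s'] of level [m]: it is an extension of [t'] if [t'] is
     short, and [t'] itself if it is long. *)
  have [s' [w [sw s'S' ls' t'w s'w]]] : exists s' w,
      [/\ strings w, s' ∈ S', strings_of_length m s', hsub t' w & hsub s' w].
    have [dm|/ltnW md] := leqP d m.
      have [s' [s'S' ls' t's']] := perfect_extend pS' t'S' lt' dm.
      by exists s', s'; split=> //; exact: lev_strings ls'.
    have [s' ls' s't'] := lev_truncate md lt'.
    exists s', t'; split=> //; first exact: lev_strings lt'.
    exact: (perfect_down pS' t'S' (lev_strings ls') s't').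
  have [s [r [rS ls sr rs' rt]]] := HS' s' s'S' ls'.
  have sw' : hsub s w by exact: (hsub_trans sr (hsub_trans rs' s'w)).
  have st0 : s = t0.
    have [st0|t0s] := hsub_comparable sw (lev_strings ls) (lev_strings lt0) sw'
      (hsub_trans t0t' t'w).
      exact: lev_eq ls lt0 st0.
    by apply: esym; exact: lev_eq lt0 ls t0s.
  have rE := rt st0; subst r.
  by have [] := hsub_comparable sw (perfect_strings pT tT) (lev_strings lt')
    (hsub_trans rs' s'w) t'w.
- by exists t; split=> // /sub.
move=> [t [tT tS]] TQ; apply: tS; exact: (limit_hsub aj (TQ t tT)).
Qed.

(** Above a node either [S] stays inside [T] or some extension [r] leaves [T], and [S] can be
    squeezed through such an [r]. Afterwards membership in [T] is settled at one level; this gives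
    the clopen trace. *)
Lemma limit_decides i xi k T : active i xi k -> P xi T -> exists n, forall s t,
  s ∈ Q xi k -> strings_of_length n s -> s ∈ T -> t ∈ Q xi k -> hsub s t -> t ∈ T.
Proof.
move=> a PT; have [xipi _] := approx_fin_unions a.
have aP := pi_arboreal small_pi xipi; have pT := aP.1 _ PT.
pose R n S := forall s, s ∈ S -> has_length s n ->
  ~ s ∈ T \/ forall t, t ∈ S -> hsub s t -> t ∈ T.
have RE n S : fin_unions (P xi) S -> R (num n) S <-> (forall s, s ∈ S -> strings_of_length n s ->
    ~ s ∈ T \/ forall t, t ∈ S -> hsub s t -> t ∈ T).
  move=> uS; have strS t := @perfect_strings S t (fin_unions_perfect aP uS).
  by split=> H s sS; have := H s sS; rewrite has_lengthP //; exact: strS.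
have [|n S uS|n S m S' uS uS'|j aj] := @gen_meet_active i xi k R a.
- have tT := term_param (tree_param tM piM xipi PT).
  by rewrite /R /has_length; definability.
- have pS := fin_unions_perfect aP uS.
  pose Phi (s r : HC) := ~ r ∈ T \/ forall t, t ∈ S -> hsub s t -> t ∈ T.
  have [s sS ls|m [S' [nm uS' leS' HS']]] := @fuse_choice _ S n Phi aP uS.
    have [H|] := pselect (forall t, t ∈ S -> hsub s t -> t ∈ T).
      by exists s; split=> //; right.
    move=> /existsNP[r /not_implyP[rS /not_implyP[sr rT]]].
    by exists r; split=> //; left.
  exists m, S'; split=> //; rewrite RE // => s' s'S' ls'.
  have [s [r [rS ls sr rs' [rT|H]]]] := HS' s' s'S' ls'.
    left=> s'T; apply: rT.
    exact: (perfect_down pT s'T (perfect_strings pS rS) rs').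
  by right=> t tS' s't; have [_ sub _] := leS'; apply: H;
    [exact: sub|exact: hsub_trans (hsub_trans sr rs') s't].
- rewrite !RE // => H le s' s'S' ls'; have [nm sub lev] := le.
  have pS := fin_unions_perfect aP uS.
  have [s ls ss'] := lev_truncate nm ls'.
  have sS : s ∈ S by apply: (perfect_down pS (sub _ s'S') (lev_strings ls) ss').
  have [nsT|HT] := H s sS ls.
    by left=> s'T; apply: nsT; exact: (perfect_down pT s'T (lev_strings ls) ss').
  by right=> t /sub tS s't; apply: HT => //; exact: hsub_trans s't.
have [_ uj] := approx_fin_unions aj.
rewrite RE // => H; exists (z j).1 => s t sQ ls sT tQ st.
have [//|] := H s (limit_hsub aj sQ) ls.
by apply=> //; exact: (limit_hsub aj).
Qed.

End Limit.

(** * The generic refinement refines [pi] *)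

Section Refines.
Variables (M pi rho : HC) (z : nat -> nat * HC).
Hypotheses (tM : htransitive M) (piM : pi ∈ M) (small_pi : small_multiforcing pi).
Hypothesis gen : generic_sequence M pi z.
Hypotheses (rho_fun : functional rho) (rho_dom : dom rho = dom pi).
Hypothesis rho_val : forall xi, dom pi xi -> ext (app rho xi) =
  [set T | exists k s, s ∈ limit_tree z xi k /\ T = cone (limit_tree z xi k) s].

Lemma rho_arboreal xi : dom pi xi -> arboreal (ext (app rho xi)).
Proof.
move=> xipi; rewrite rho_val //.
have pQ k s : s ∈ limit_tree z xi k -> perfect_tree (limit_tree z xi k).
  by move=> /limit_active[j a]; exact: (limit_perfect tM piM small_pi gen a).
split=> [_ [k [s [sQ ->]]]|_ u [k [s [sQ ->]]] uT].
  by apply: cone_perfect => //; exact: pQ sQ.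
by have [r rQ ->] := cone_cone (pQ k s sQ) sQ uT; exists k, r.
Qed.

Lemma generic_refines : mf_refines pi rho.
Proof.
have mfpi : multiforcing pi by have [] := small_pi.
split=> //; first by split; rewrite ?rho_dom //; [have [] := mfpi|exact: rho_arboreal].
  by rewrite rho_dom.
move=> xi xipi; have aP := pi_arboreal small_pi xipi.
split=> //; first exact: rho_arboreal.
all: rewrite rho_val //.
- move=> T PT; have [j [k [a sub]]] := gen_below tM piM small_pi gen xipi PT.
  have pQ := limit_perfect tM piM small_pi gen a.
  (* The empty string is a node of every perfect tree, so a cone is always available. *)
  have r0 := perfect_empty (fun=> false) pQ.
  exists (cone (limit_tree z xi k) (restr (fun=> false) 0)).
    by exists k; eexists; split; [exact: r0|].

  apply: hsub_trans sub; apply: hsub_trans (limit_hsub small_pi gen a).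
  exact: cone_hsub.
- move=> _ [k [s [sQ ->]]]; have [j a] := limit_active sQ.
  have [_ [Z [fZ _ ZP TE]]] := approx_fin_unions gen a.
  exists Z; split=> //; rewrite -TE.
  by apply: hsub_trans (limit_hsub small_pi gen a); exact: cone_hsub.
move=> _ T [k [s [sQ ->]]] PT; have [j a] := limit_active sQ.
have pT := aP.1 _ PT.
split; last first.
  move=> TQ; apply: (limit_not_above tM piM small_pi gen a PT).
  by apply: hsub_trans TQ _; exact: cone_hsub.
have [n Qn] := limit_decides tM piM small_pi gen a PT.
set C := cone _ _.
(* Within the cone, the first [n] values of a branch decide whether it is a branch of [T]. *)
have -> : branches C `&` branches T = [set x | restr x n ∈ T] `&` branches C.
  apply/seteqP; split=> x [xC xT]; split=> //; first exact: xT.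
  move=> m; have Cx i : restr x i ∈ limit_tree z xi k := cone_hsub (xT i).
  have [mn|nm] := leqP m n.
    by apply: (perfect_down pT xC); [exists m => //; exact: lev_restr|rewrite hsub_restr].
  by apply: (Qn _ _ (Cx n) (lev_restr x n) xC (Cx m)); rewrite hsub_restr ltnW.
have [oT cT] := clopen_initial n (fun s => s ∈ T).
apply: clopenI; split.
- exact: open_subspaceW.
- exact: closed_subspaceW.
- exact: open_subspaceT.
- exact: closed_subspaceT.
Qed.

End Refines.

(** * Multitrees and their order *)

Section Multitrees.
Variable pi : HC.
Hypothesis small_pi : small_multiforcing pi.

Let P xi := ext (app pi xi).

Lemma MT_intro q : functional q -> finite_set (dom q) ->
  (forall xi, dom q xi -> dom pi xi /\ P xi (app q xi)) -> MT pi q.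
Proof.
move=> fq dq H; have [[_ pio _] _ _] := small_pi.
split; last by move=> xi /H[].
  split=> //; first by move=> xi /H[/pio].
  by move=> xi /H[xipi Pq]; apply: (pi_arboreal small_pi xipi).1.
by move=> xi /H[].
Qed.

Lemma MT_functional q : MT pi q -> functional q.
Proof. by case=> -[]. Qed.

Lemma MT_finite q : MT pi q -> finite_set (dom q).
Proof. by case=> -[]. Qed.

Lemma MT_val q xi : MT pi q -> dom q xi -> dom pi xi /\ P xi (app q xi).
Proof. by case=> _ dq Hq dx; split; [exact: dq|exact: Hq]. Qed.

Lemma MTP q : MT pi q <-> functional q /\ finite_set (ext q) /\
  forall xi T, opair xi T ∈ q -> exists U, opair xi U ∈ pi /\ T ∈ U.
Proof.
split=> [mq|[fq [/functional_finite fin H]]].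
  have fq := MT_functional mq; split=> //; split.
    by apply/(functional_finite fq); exact: MT_finite.
  move=> xi T xiT; have [|xipi PT] := @MT_val q xi mq; first by exists T.
  exists (app pi xi); split; first exact: app_in.
  by rewrite -(app_eq fq xiT).
apply: MT_intro => //; first exact: fin.
move=> xi [T /[dup] xiT /H[U [xiU TU]]]; split; first by exists U.
by rewrite /P (app_eq (pi_functional small_pi) xiU) (app_eq fq xiT).
Qed.

Lemma mt_leP q p : functional q -> functional p -> mt_le q p <->
  forall xi T, opair xi T ∈ p -> exists T', opair xi T' ∈ q /\ hsub T' T.
Proof.
move=> fq fp; split=> [[dpq le] xi T xiT|H].
  have dx : dom p xi by exists T.
  exists (app q xi); split; first by apply: app_in; exact: dpq.
  by rewrite -(app_eq fp xiT); exact: le.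
split=> [xi [T /H[T' [? _]]]|xi [T /[dup] xiT /H[T' [xiT' sub]]]]; first by exists T'.
by rewrite (app_eq fp xiT) (app_eq fq xiT').
Qed.

Lemma mt_le_trans r q p : mt_le r q -> mt_le q p -> mt_le r p.
Proof.
move=> [dqr rq] [dpq qp]; split=> [|xi dx]; first exact: subset_trans dqr.
by apply: hsub_trans (qp xi dx); exact: rq (dpq xi dx).
Qed.

Lemma hunion_MT w q : MT pi w -> MT pi q -> dom w `&` dom q = set0 -> MT pi (hunion w q).
Proof.
move=> mw mq wq0; have fw := MT_functional mw; have fq := MT_functional mq.
apply: MT_intro; first exact: hunion_functional.
  by rewrite dom_hunion finite_setU; split; exact: MT_finite.
move=> xi; rewrite dom_hunion => -[dx|dx].
  by rewrite /P app_hunionl //; exact: MT_val.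
by rewrite /P app_hunionr //; exact: MT_val.
Qed.

Lemma hunion_le w' q' w q : functional w' -> functional q' -> functional w -> functional q ->
  dom w' `&` dom q' = set0 -> dom w `&` dom q = set0 ->
  mt_le w' w -> mt_le q' q -> mt_le (hunion w' q') (hunion w q).
Proof.
move=> fw' fq' fw fq wq0' wq0 [dw lw] [dq lq]; split; rewrite !dom_hunion; first exact: setUSS.
move=> xi [dx|dx].
  by rewrite !app_hunionl //; [exact: lw|exact: dw].
by rewrite !app_hunionr //; [exact: lq|exact: dq].
Qed.

(** * Meeting [Delta] for all choices of nodes *)

Section Selectors.
Variables (A : set HC) (S : HC -> HC) (n : nat) (p : HC) (Delta : set HC).
Hypotheses (fA : finite_set A) (Api : A `<=` dom pi).
Hypothesis uS : forall xi, A xi -> fin_unions (P xi) (S xi).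
Hypotheses (mp : MT pi p) (Ap0 : dom p `&` A = set0).
Hypothesis odD : open_dense mt_le (MT pi) Delta.

Let cA : countable A := finite_set_countable fA.

Definition selectors : set HC :=
  [set g | [/\ functional g, dom g = A &
     forall xi, A xi -> app g xi ∈ S xi /\ strings_of_length n (app g xi)]].

Definition selected (F : HC -> HC -> HC) (g : HC) : HC :=
  mkfun A (fun xi => F xi (app g xi)).

Lemma finite_selectors : finite_set selectors.
Proof.
apply: (@sub_finite_set _ _ [set g | ext g `<=`
    (fun w => opair w.1 w.2) @` (A `*` strings_of_length n)]); last first.
  by apply: finite_hcpowerset; apply: finite_image; apply: finite_setX => //; exact: finite_level.
move=> g [fg dg gS] w /(in_functional _ fg)[xi]; rewrite dg => Axi ->.
by exists (xi, app g xi) => //; split=> //; have [] := gS xi Axi.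
Qed.

Definition fusible_all (F : HC -> HC -> HC) : Prop :=
  forall xi, A xi -> fusible (P xi) (S xi) n (F xi).

Lemma selected_MT F g : fusible_all F -> selectors g -> MT pi (selected F g).
Proof.
move=> fF [fg dg gS]; apply: MT_intro; first exact: mkfun_functional.
  by rewrite dom_mkfun.
rewrite dom_mkfun // => xi Axi; split; first exact: Api.
by rewrite app_mkfun //; have [gxS lg] := gS xi Axi; have [] := fF xi Axi _ gxS lg.
Qed.

(** Meeting [Delta] for one selector at a time only shrinks the chosen trees, so
    by openness the selectors already treated are not disturbed. *)
Lemma selectors_dense : exists F q,
  [/\ fusible_all F, MT pi q, mt_le q p, dom q `&` A = set0 &
      forall g, selectors g -> Delta (hunion (selected F g) q)].
Proof.
have [DMT denD opD] := odD.
suff H G : finite_set G -> G `<=` selectors -> exists F q,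
    [/\ fusible_all F, MT pi q, mt_le q p, dom q `&` A = set0 &
        forall g, G g -> Delta (hunion (selected F g) q)].
  exact: H finite_selectors _.
have disj F g q : dom q `&` A = set0 -> dom (selected F g) `&` dom q = set0.
  by move=> q0; rewrite dom_mkfun // setIC.
elim/finite_set_rect: G / => [_|g G fG IH gG].
  (* To start, any tree of [P xi] through [s] inside [S xi] is cut to its cone at [s]; the default
     [hc0] is excluded by [fin_unions_member]. *)
  exists (fun xi s => cone (xget hc0 [set T | [/\ P xi T, s ∈ T & hsub T (S xi)]]) s), p.
  split=> //; first last; [by split|].
  move=> xi Axi s sS ls; have [_ aP] := pi_arboreal small_pi (Api Axi).
  case: xgetP => [T _ [PT sT TS]|/= no]; last first.
    by have [T ?] := fin_unions_member (uS Axi) sS; case: (no T).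
  split; [exact: aP|exact: cone_root|].
  by move=> t /in_cone[tT st]; rewrite /ext /= in_cone; split=> //; exact: TS.
have [|F [q [fF mq qp q0 DF]]] := IH.
  by move=> h Gh; apply: gG; right.
have sg : selectors g by apply: gG; left.
have [fg dg gS] := sg.
have mwq : MT pi (hunion (selected F g) q).
  by apply: hunion_MT => //; [exact: selected_MT|exact: disj].
have [d Dd [dle led]] := denD _ mwq.
have md := DMT d Dd; have fd := MT_functional md.
have fsel F' h : functional (selected F' h) by exact: mkfun_functional.
have fq := MT_functional mq.
have Ad : A `<=` dom d.
  by move=> xi Axi; apply: dle; rewrite dom_hunion; left; rewrite dom_mkfun.
have dF xi : A xi -> hsub (app d xi) (F xi (app g xi)).
  move=> Axi; have := led xi; rewrite dom_hunion app_hunionl //; try exact: disj.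
    by rewrite app_mkfun //; apply; left; rewrite dom_mkfun.
  by rewrite dom_mkfun.
(* The condition [d] is split in two: its values on [A] replace the trees at the nodes chosen by
   [g], and its part outside [A] becomes the new side multitree [q']. *)
pose F' xi s := if pselect (s = app g xi) then app d xi else F xi s.
pose B := dom d `\` A.
have fB : finite_set B by apply: sub_finite_set (MT_finite md); exact: subDsetl.
have cB : countable B := finite_set_countable fB.
pose q' := mkfun B (app d).
have F'F xi s : A xi -> hsub (F' xi s) (F xi s).
  by move=> Axi; rewrite /F'; case: pselect => //= E; rewrite E; exact: dF.
have fF' : fusible_all F'.
  move=> xi Axi s sS ls; have [PF sF FS] := fF xi Axi s sS ls.
  have sub := F'F xi s Axi; split; last exact: hsub_trans FS.
    rewrite /F'; case: pselect => [E|//] /=.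
    by have [] := MT_val md (Ad _ Axi).
  move: sub; rewrite /F'; case: pselect => [E|//] /= sub.
  have [xipi Pd] := MT_val md (Ad _ Axi).
  have [t td lt] := perfect_level n ((pi_arboreal small_pi xipi).1 _ Pd).
  suff -> : s = t by [].
  have /FS/in_cone[_ st] := sub t td.
  exact: (lev_eq ls lt (comparable_hsub ls lt (leqnn n) st)).
have fq' : functional q' by exact: mkfun_functional.
have mq' : MT pi q'.
  apply: MT_intro => //; rewrite dom_mkfun //.
  by move=> xi Bxi; rewrite /P app_mkfun //; apply: MT_val => //; case: Bxi.
have q'q : mt_le q' q.
  have qB : dom q `<=` B.
    move=> xi dx; split; first by apply: dle; rewrite dom_hunion; right.
    by move=> Axi; rewrite -[False]/(set0 xi) -q0.
  split; first by rewrite dom_mkfun.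
  move=> xi dx; rewrite app_mkfun //; last exact: qB.
  have := led xi; rewrite dom_hunion app_hunionr //; last exact: disj.
  by apply; right.
have q'0 : dom q' `&` A = set0.
  by rewrite dom_mkfun //; apply/seteqP; split=> // xi [[]].
exists F', q'; split=> //; first exact: mt_le_trans q'q qp.
have mnew h : selectors h -> MT pi (hunion (selected F' h) q').
  by move=> sh; apply: hunion_MT => //; [exact: selected_MT|exact: disj].
move=> h [->|Gh].
  (* For [g] itself the new union has the values of [d], so it lies below [d]. *)
  apply: (opD d) => //; first exact: mnew.
  split; rewrite ?dom_hunion ?dom_mkfun //.
    by move=> xi dx; have [Axi|nA] := pselect (A xi); [left|right].
  move=> xi dx; have [Axi|nA] := pselect (A xi).
    rewrite app_hunionl ?dom_mkfun //; last by rewrite setIC -(dom_mkfun (app d) cB).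
    by rewrite app_mkfun // /F'; case: pselect.
  rewrite app_hunionr ?dom_mkfun //; last by rewrite setIC -(dom_mkfun (app d) cB).
  by rewrite app_mkfun.
have sh : selectors h by apply: gG; right.
apply: (opD (hunion (selected F h) q)); [exact: DF|exact: mnew|].
apply: hunion_le => //; try exact: disj.
split; rewrite !dom_mkfun // => xi Axi; rewrite !app_mkfun //.
exact: F'F.
Qed.

End Selectors.
End Multitrees.

(** * Genericity applied to the sealing condition *)

Section Sealing.
Variables (M pi : HC) (z : nat -> nat * HC).
Hypotheses (tM : htransitive M) (piM : pi ∈ M) (small_pi : small_multiforcing pi).
Hypothesis gen : generic_sequence M pi z.

Let P xi := ext (app pi xi).

Lemma def_MT t : definable_term M t -> definable M (fun e => MT pi (t e)).
Proof.
apply: (@def_app1 _ (MT pi)).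
apply: def_ext => [e|]; first by apply: iff_sym; exact: (MTP small_pi).
have tpi := term_param piM; definability.
Qed.

Lemma term_MT p : MT pi p -> definable_term M (fun=> p).
Proof.
move=> /(MTP small_pi)[fp [finp pU]]; rewrite -[p]hcset_ext; apply: term_finite => // w wp.
have [xi [T E]] := fp.1 w wp; subst w; have [U [xiU TU]] := pU _ _ wp.
have [xiM UM] := mem_opair_param tM piM xiU.
by apply: term_opair; apply: term_param => //; exact: (tM UM).
Qed.

(** The dense condition behind sealing: [a] is the domain of the multitree to be
    sealed, [c] the set of indices of the corresponding generic trees, and [p] the
    multitree to be refined; [h] runs over choices of a node in each of these trees. *)
Definition sealing (D : set HC) (a c p phi : HC) : Prop :=
  (forall i, i ∈ c -> dom phi i) /\
  exists q W, MT pi q /\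
    (forall xi T, opair xi T ∈ p -> exists T', opair xi T' ∈ q /\ hsub T' T) /\
    (forall xi, dom q xi -> ~ xi ∈ a) /\
    finite_set (ext W) /\
    (forall w, w ∈ W -> MT pi w /\ (forall xi, dom w xi <-> xi ∈ a) /\ D (hunion w q)) /\
    forall h, functional h ->
      (forall xi k S, opair xi k ∈ c -> opair (opair xi k) S ∈ phi ->
         exists s, opair xi s ∈ h /\ s ∈ S) ->
      exists w, w ∈ W /\ forall xi, xi ∈ a ->
        exists s T, opair xi s ∈ h /\ opair xi T ∈ w /\ s ∈ T.

Lemma def_sealing D a c p : definable M (fun e => D (e 0)) ->
  definable_term M (fun=> a) -> definable_term M (fun=> c) -> definable_term M (fun=> p) ->
  definable M (fun e => sealing D a c p (e 1)).
Proof.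
move=> dD ta tc tp; rewrite /sealing; definability.
- by apply: def_MT; exact: term_var.
- by apply: def_MT; exact: term_var.
- by apply: (def_app1 dD); definability.
Qed.

Section OneMultitree.
Variables (A : set HC) (kap : HC -> nat) (p : HC) (D : set HC).
Hypotheses (fA : finite_set A) (Api : A `<=` dom pi).
Hypothesis PA : forall xi, A xi -> P xi !=set0.
Hypotheses (mp : MT pi p) (Ap0 : dom p `&` A = set0).
Hypothesis odD : open_dense mt_le (MT pi) D.
Hypothesis defD : definable M (fun e => D (e 0)).

Let cA : countable A := finite_set_countable fA.
Let a := hcset A.
Let c := hcset [set opair xi (num (kap xi)) | xi in A].

Let in_a xi : xi ∈ a <-> A xi.
Proof. exact: in_hcset. Qed.

Let fc : finite_set [set opair xi (num (kap xi)) | xi in A].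
Proof. exact: finite_image. Qed.

Let in_c i : i ∈ c <-> exists2 xi, A xi & opair xi (num (kap xi)) = i.
Proof. exact: in_hcset (finite_set_countable fc). Qed.

Lemma sealing_dense n phi : system pi phi -> exists m phi',
  [/\ system pi phi', system_le (m, phi') (n, phi) & sealing D a c p phi'].
Proof.
move=> sphi.
have [|phi1 [sphi1 le1 dphi1]] := @extend_system pi phi n _ sphi fc.
  by move=> _ [xi Axi <-]; exists xi, (kap xi); split=> //; [exact: Api|exact: PA].
pose S xi := app phi1 (opair xi (num (kap xi))).
have uS xi : A xi -> fin_unions (P xi) (S xi).
  move=> Axi; have [_ _ _ u] := sphi1; apply: u.
  by apply: dphi1; exists xi.
have [F [q [fF mq qp q0 DF]]] := selectors_dense small_pi n fA Api uS mp Ap0 odD.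
pose fst i := xget hc0 [set x | exists y, i = opair x y].
have fstE x y : fst (opair x y) = x.
  by rewrite /fst; case: xgetP => [x' _ [y' /opair_inj[]]//|/(_ x)]; case; exists y.
pose G i := if pselect (i ∈ c) then fuse (app phi1 i) n (F (fst i)) else app phi1 i.
have GE xi : A xi -> G (opair xi (num (kap xi))) = fuse (S xi) n (F xi).
  move=> Axi; rewrite /G; case: pselect => [ic|[]] /=; first by rewrite fstE.
  by rewrite in_c; exists xi.
have [_ fphi1 _ _] := sphi1; have cphi1 := finite_set_countable fphi1.
(* The number [n] stays, because fusion leaves level [n] intact. *)
have [i di|i di|sG leG] :=
  @update_system pi phi1 (dom phi1) G n n sphi1 fphi1 (@subset_refl _ _) (leqnn n).
- have [/in_c[xi Axi <-]|nc] := pselect (i ∈ c).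
    exists xi, (kap xi); split=> //; first exact: Api.
    rewrite GE //; apply: (fuse_fin_unions (pi_arboreal small_pi (Api Axi))); first exact: uS.
    exact: fF.
  by rewrite /G; case: pselect => [//|_] /=; exact: system_index.
- have [/in_c[xi Axi <-]|nc] := pselect (i ∈ c).
    by rewrite GE //; apply: fuse_le => //; exact: fF.
  by rewrite /G; case: pselect => [//|_] /=; split.
exists n, (mkfun (dom phi1) G); split=> //.
  exact: (@system_le_trans pi small_pi (n, _) (n, phi1) (n, phi) sG sphi1 leG le1).
split; first by move=> i /in_c ic; rewrite dom_mkfun //; exact: dphi1.
have fW : finite_set (selected A F @` selectors A S n).
  by apply: finite_image; exact: finite_selectors.
exists q, (hcset (selected A F @` selectors A S n)); split=> //.
have fq := MT_functional mq; have fp := MT_functional mp.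
split; first exact/(mt_leP fq fp).
split; first by move=> xi dx /in_a Axi; rewrite -[False]/(set0 xi) -q0.
have cW := finite_set_countable fW.
split; first by rewrite hcsetE.
split=> [w|h fh hS].
  rewrite in_hcset // => -[g sg <-].
  split; first exact: (selected_MT small_pi fA Api fF).
  by split; [move=> xi; rewrite dom_mkfun // in_a|exact: DF].
(* A node of the fused tree lies in [F xi s] for some [s] of level [n]; collecting these [s] gives
   the selector whose multitree contains the whole choice [h]. *)
have hF xi : A xi -> exists s, [/\ s ∈ S xi, strings_of_length n s &
    exists t, opair xi t ∈ h /\ t ∈ F xi s].
  move=> Axi; have cxi : opair xi (num (kap xi)) ∈ c by rewrite in_c; exists xi.
  have [|t [xit]] := hS xi _ (G (opair xi (num (kap xi)))) cxi.
    rewrite pair_in_mkfun //; split=> //; apply: dphi1.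
    by exists xi.
  by rewrite GE // => /in_fuse[s [sS ls tF]]; exists s; split=> //; exists t.
have [g gP] := select (R := fun xi s => [/\ s ∈ S xi, strings_of_length n s &
    exists t, opair xi t ∈ h /\ t ∈ F xi s]) hF.
have sg : selectors A S n (mkfun A g).
  split; [exact: mkfun_functional|by rewrite dom_mkfun|].
  by move=> xi Axi; rewrite app_mkfun //; have [] := gP xi Axi.
exists (selected A F (mkfun A g)); split; first by rewrite in_hcset //; exists (mkfun A g).
move=> xi /in_a Axi; have [_ _ [t [xit tF]]] := gP xi Axi.
exists t, (F xi (g xi)); split=> //; split=> //.
by rewrite pair_in_mkfun // app_mkfun.
Qed.

(** Smaller trees leave fewer choices [h] to cover, so the same [q] and [W] serve. *)
Lemma sealing_open phi phi' n m : system pi phi -> sealing D a c p phi ->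
  system pi phi' -> system_le (m, phi') (n, phi) -> sealing D a c p phi'.
Proof.
move=> [fphi _ _ _] [dphi [q [W [mq [qp [q0 [fW [WD cov]]]]]]]] [fphi' _ _ _] [_ sub le].
split; first by move=> i /dphi /sub.
exists q, W; do 5!split=> //; move=> h fh hS; apply: cov => // xi k T ck kT.
have dk : dom phi (opair xi k) by exists T.
have [s [xis sS]] := hS xi k _ ck (app_in (sub _ dk)).
exists s; split=> //; have [_ lek _] := le _ dk.
by rewrite -(app_eq fphi kT); exact: lek.
Qed.

Lemma gen_sealing : exists j, sealing D a c p (z j).2.
Proof.
apply: (gen_meet tM piM small_pi gen (R := fun _ phi => sealing D a c p phi)).
- apply: def_sealing => //; last exact: term_MT.
    by apply: term_finite => // xi /Api /(dom_param tM piM); exact: term_param.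
  by apply: term_finite => // _ [xi Axi <-]; apply: (term_index tM piM); exact: Api.
- exact: sealing_dense.
- by move=> n phi m phi' sphi sea sphi' le; exact: sealing_open sea sphi' le.
Qed.

End OneMultitree.
End Sealing.


(** * From covered nodes to covered branches *)

Theorem theorem8p1 (M pi rho Delta : HC) :
  htransitive M ->
  pi ∈ M ->
  small_multiforcing pi ->
  generic_refinement M pi rho ->
  Mplus M Delta ->
  ext Delta `<=` MT pi ->
  open_dense mt_le (MT pi) (ext Delta) ->
  seals (ext Delta) pi rho.
Proof.
move=> tM piM small_pi [z [gen frho drho vrho]] /Mplus_definable defD _ odD.
split; first exact: generic_refines gen frho drho vrho.
move=> p u mp mu upi up0.
have [[fu finu uo _] _ uval] := mu.
pose Q := limit_tree z.
(* The value of [u] may be a cone of several limit trees; one number is fixed for each [xi]. The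
   default 0 is never taken on [dom u]. *)
pose kap xi := xget 0 [set k | exists s, s ∈ Q xi k /\ app u xi = cone (Q xi k) s].
have kapP xi : dom u xi -> exists s, s ∈ Q xi (kap xi) /\ app u xi = cone (Q xi (kap xi)) s.
  move=> du; have : ext (app rho xi) (app u xi) by exact: uval.
  rewrite vrho; last exact: upi.
  move=> [k [s H]]; rewrite /kap; case: xgetP => // /(_ k)[].
  by exists s.
have act xi : dom u xi -> exists j, dom (z j).2 (opair xi (num (kap xi))).
  by move=> /kapP[s [/limit_active[j a] _]]; exists j.
have Pu xi : dom u xi -> ext (app pi xi) !=set0.
  by move=> /act[j a]; exact: (active_nonempty gen a).
have pu0 : dom p `&` dom u = set0 by rewrite setIC.
have [j [dj [q [W [mq [qp [q0 [fW [WD cov]]]]]]]]] :=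
  gen_sealing tM piM small_pi gen kap finu upi Pu mp pu0 odD defD.
have cu := finite_set_countable finu.
have in_u xi : xi ∈ hcset (dom u) <-> dom u xi by exact: in_hcset.
have active xi : dom u xi -> dom (z j).2 (opair xi (num (kap xi))).
  move=> du; apply: dj; rewrite in_hcset; first by exists xi.
  exact/finite_set_countable/finite_image.
exists q; split=> //.
- by apply/mt_leP; [exact: MT_functional mq|exact: MT_functional mp|].
- by apply/seteqP; split=> // xi [dq du]; apply: (q0 xi dq); rewrite in_u.
have domW w : w ∈ W -> dom w = dom u.
  by move=> /WD[_ [dw _]]; apply/seteqP; split=> xi; rewrite dw in_u.
exists (ext W); split=> //.
  by move=> w wW; have [mw [_ Dw]] := WD w wW; split=> //; exact: domW.
move=> x xu.
(* [x] is indexed by the subtype of [omega1]; [y] extends it to HC by a default value that does not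
   occur on [dom u]. *)
pose y xi : cantor_space := if insub xi is Some i then x i else point.
have yu xi : dom u xi -> branches (app u xi) (y xi).
  move=> du; have oxi : xi \in omega1 by rewrite inE; exact: uo.
  have := xu (Sub xi oxi); rewrite SubK => /(_ du).
  by rewrite /y insubT.
have cover m : exists2 w, w ∈ W & forall xi, dom u xi -> restr (y xi) m ∈ app w xi.
  (* The restrictions of the branches to [m] are nodes of limit trees, hence of the approximations
     at stage [j], and so form a choice to which [cov] applies. *)
  pose h := mkfun (dom u) (fun xi => restr (y xi) m).
  have hE xi s : opair xi s ∈ h <-> dom u xi /\ s = restr (y xi) m by exact: pair_in_mkfun.
  have [|xi k S|w [wW wh]] := cov h; first exact: mkfun_functional.
    rewrite in_hcset; last exact/finite_set_countable/finite_image.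
    move=> [xi' du /opair_inj[E E']] iS; subst xi' k.
    exists (restr (y xi) m); rewrite hE; split=> //.
    have [s0 [_ uE]] := kapP xi du; have := yu xi du m; rewrite uE => /cone_hsub.
    move=> /(limit_hsub small_pi gen (active xi du)).
    by have [fz _ _ _] := gen_system gen j; rewrite (app_eq fz iS).
  exists w => // xi du; have [s [T [/hE[_ ->] [xiT sT]]]] := wh xi ((in_u xi).2 du).
  by rewrite (app_eq (MT_functional (WD w wW).1) xiT).
(* A covering multitree for each length, and finitely many candidates: a common
   bound on the lengths at which the candidates fail gives a contradiction. *)
apply: contrapT => nW.
have miss w : w ∈ W -> exists m, exists2 xi, dom u xi & ~ restr (y xi) m ∈ app w xi.
  move=> wW; apply: contrapT => H; apply: nW; exists w => // xi.
  rewrite domW // => du m; apply: contrapT => nm; apply: H; exists m, (val xi) => //.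
  by rewrite /y valK.
pose len w := xget 0 [set m | exists2 xi, dom u xi & ~ restr (y xi) m ∈ app w xi].
have [N lenN] := finite_bound len fW.
have [w wW wN] := cover N; have [m0 miss0] := miss w wW.
have : exists2 xi, dom u xi & ~ restr (y xi) (len w) ∈ app w xi.
  by rewrite /len; case: xgetP => [//|/(_ m0)].
move=> [xi du]; apply; have dw : dom w xi by rewrite domW.
have [mw _] := WD w wW; have [[_ _ _ pw] _ _] := mw.
(* The multitree found at length [N] contains all shorter restrictions, in particular the one at its
   own failing length. *)
apply: (perfect_down (pw xi dw) (wN xi du)); first by exists (len w) => //; exact: lev_restr.
by rewrite hsub_restr; split=> //; exact: lenN.
Qed.
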